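(* Let $s\in L^2([0,1]^2)$ with $s\ge0$ on $[0,1]^2$, and let $(Sg)(x)=\int_0^1s(x,y)g(y)\,dy$. For any fixed $z\in\mathbb{C}^+$ there exists a unique $L^2$ function $g_z:[0,1]\to\mathbb{C}^+$ satisfying $$g_z(x)=-\frac{1}{z+(Sg_z)(x)}.$$ Moreover, $z\mapsto g_z$, as a function from $\mathbb{C}^+$ to $L^2[0,1]$, is holomorphic.
   Context: $\mathbb{C}^+$ is the open upper half plane. Functions in $L^2$ are complex-valued and identified when equal almost everywhere, and the equation is understood in $L^2[0,1]$. *)

(* Defs.v *)
From HB Require Import structures.
From mathcomp Require Import all_boot all_order all_algebra.
From mathcomp Require Import complex.
From mathcomp Require Import all_classical all_reals all_analysis.
Set Implicit Arguments.
Unset Strict Implicit.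
Unset Printing Implicit Defensive.
Import Order.TTheory GRing.Theory Num.Theory.
Import numFieldNormedType.Exports.

Local Open Scope classical_set_scope.
Local Open Scope ring_scope.
Local Open Scope complex_scope.

Lemma measurable_I01 (R : realType) :
  measurable (`[0%R, 1%R]%classic : set (measurableTypeR R)).
Proof. exact: measurable_itv. Qed.

Lemma lebesgue_I01_lty (R : realType) :
  (lebesgue_measure (`[0%R, 1%R]%classic : set (measurableTypeR R)) < +oo)%E.
Proof. by rewrite lebesgue_measure_itv/= lte01 oppr0 adde0 ltry. Qed.

(* Lebesgue measure on [0, 1], as a finite measure on R vanishing outside
   [0, 1]: a function on [0, 1] (resp. [0, 1]^2) is represented by an arbitrary
   Borel function on R (resp. R * R), and only its almost everywhere class for
   mu01 (resp. the product mu01 \x mu01) matters. *)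
Definition mu01 (R : realType) :
    {finite_measure set (measurableTypeR R) -> \bar R} :=
  mfrestr (@measurable_I01 R) (@lebesgue_I01_lty R).

Definition upper_half_plane (R : realType) : set R[i] :=
  [set z | 0 < complex.Im z].

Section ComplexL2.
Context d (T : measurableType d) (R : realType).
Variable mu : {measure set T -> \bar R}.
Implicit Type f : T -> R[i].

Definition L2C f : Prop :=
  (@complex.Re R \o f \in Lfun mu 2%:E) /\ (@complex.Im R \o f \in Lfun mu 2%:E).

Definition L2norm f : \bar R :=
  'N[mu]_2%:E[(fun x => (ComplexField.Normc.normc (f x))%:E)]%E.

Definition cintegral f : R[i] :=
  (\int[mu]_x complex.Re (f x)) +i* (\int[mu]_x complex.Im (f x)).

(* Complex differentiability, in L2-norm, of a function on D whose values are
   (representatives of) elements of L2; D is meant to be open. The scalar h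
   ranges over R[i]^o, the type R[i] with its normed-space topology. *)
Definition holomorphic_L2 (D : set R[i]) (G : R[i] -> T -> R[i]) : Prop :=
  forall z, D z -> L2C (G z) /\
    exists2 G' : T -> R[i], L2C G' &
      L2norm (fun x => h^-1 * (G (z + h) x - G z x) - G' x)
        @[h --> (0 : R[i]^o)^'] --> 0%E.

End ComplexL2.

Section Equation.
Context (R : realType).
Implicit Types (s : R * R -> R) (z : R[i]) (g : R -> R[i]).

Definition S_op s g : R -> R[i] :=
  fun x => cintegral (mu01 R) (fun y => (s (x, y))%:C * g y).

Definition is_solution s z g : Prop :=
  [/\ L2C (mu01 R) g,
      {ae mu01 R, forall x, upper_half_plane (g x)} &
      {ae mu01 R, forall x, g x = - (1 / (z + S_op s g x))}].

End Equation.

(* Main.v *)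
Require Import Defs.
From HB Require Import structures.
From mathcomp Require Import all_boot all_order all_algebra.
From mathcomp Require Import complex ring lra.
From mathcomp Require Import all_classical all_reals all_analysis measurable_realfun.
Set Implicit Arguments.
Unset Strict Implicit.
Unset Printing Implicit Defensive.
Import Order.TTheory GRing.Theory Num.Theory.
Import numFieldNormedType.Exports.

Local Open Scope classical_set_scope.
Local Open Scope ring_scope.
Local Open Scope complex_scope.

(** Put F z g = - 1 / (z + S g). If Im z >= eta > 0 and Im g >= 0, then F z g has
    positive imaginary part and modulus at most 1 / eta, and two images differ by
      |F z1 g1 - F z2 g2| <= m (|z1 - z2| + S |g1 - g2|),  m = |F z1 g1| |F z2 g2|.
    The kernel is neither symmetric nor bounded, so positive operators of the form
    q |-> m S q are controlled by an explicit positive function, the barrier, which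
    combines two facts.

    - The imaginary parts v_i of g_i give a supersolution. Since
      Im (-1/w) = |1/w|^2 Im w, Cauchy-Schwarz yields
      m (eta + S sqrt (v1 v2)) <= sqrt (Im (F z1 g1) Im (F z2 g2))
      ([geom_mean_Im_supersolution]).
    - A square integrable kernel is bounded up to a part of small Hilbert-Schmidt
      norm. Hence for every kappa > 0 there is a square integrable rho >= 1 with
      S rho <= kappa rho + C ([sublinear_weight_exists]).

    In a suitable combination, a rho + sqrt (v1 v2), the gain m eta of the first
    fact absorbs the constant C of the second, and rho >= 1 makes the supersolution
    strict: q |-> m S q contracts by a fixed factor in the sup norm weighted by the
    barrier ([barrier_contraction]).

    Everything follows pointwise. Picard iterates converge geometrically
    ([solution_exists]). A comparison principle ([barrier_comparison]) gives
    |g_z - g_w| <= |z - w| / eta^2 ([solution_lipschitz]), hence uniqueness. The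
    difference quotients of z |-> g_z satisfy a linear equation of the same type, so
    two of them differ by at most a multiple of rho times the distance of the
    increments ([quotient_sub_le]); they converge, at a rate controlled by rho in
    L2, which is holomorphy ([solution_derivative]).

    The kernel is first modified on a null set ([tame_modification]), and solutions
    are replaced by almost everywhere equal ones that solve the equation at every
    point ([solution_is_fixed_point]), so that no exceptional set is carried
    along. *)

(** * Modulus and imaginary part of complex numbers *)

Section ComplexModulus.
Variable R : realType.
Implicit Types z w : R[i].
Local Notation normc := (@ComplexField.Normc.normc R).
Local Notation Re := (@complex.Re R).
Local Notation Im := (@complex.Im R).

Lemma normc_ge0 z : 0 <= normc z.
Proof. by case: z => a b; exact: sqrtr_ge0. Qed.

Lemma ReD z w : Re (z + w) = Re z + Re w.
Proof. by case: z; case: w. Qed.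

Lemma ImD z w : Im (z + w) = Im z + Im w.
Proof. by case: z; case: w. Qed.

Lemma sqr_normcE z : normc z ^+ 2 = Re z ^+ 2 + Im z ^+ 2.
Proof. by case: z => a b /=; rewrite sqr_sqrtr// addr_ge0// sqr_ge0. Qed.

Lemma Re_le_normc z : `|Re z| <= normc z.
Proof.
rewrite -(@ler_pXn2r _ 2)// ?nnegrE ?normc_ge0// sqr_normcE real_normK ?num_real//.
by rewrite lerDl sqr_ge0.
Qed.

Lemma Im_le_normc z : `|Im z| <= normc z.
Proof.
rewrite -(@ler_pXn2r _ 2)// ?nnegrE ?normc_ge0// sqr_normcE real_normK ?num_real//.
by rewrite lerDr sqr_ge0.
Qed.

Lemma normc_le_ReIm z : normc z <= `|Re z| + `|Im z|.
Proof.
rewrite -(@ler_pXn2r _ 2)// ?nnegrE ?normc_ge0 ?addr_ge0// sqr_normcE.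
rewrite sqrrD !real_normK ?num_real// addrAC lerDl mulrn_wge0//.
Qed.

Lemma normcB_sym z w : normc (z - w) = normc (w - z).
Proof. by rewrite -(normcN (z - w)) opprB. Qed.

Lemma normc_leB z w : normc (z - w) <= normc z + normc w.
Proof. by rewrite -(normcN w); exact: le_normcD. Qed.

Lemma normc_real (a : R) : normc a%:C = `|a|.
Proof. by rewrite /= expr0n/= addr0 sqrtr_sqr. Qed.

Lemma Im_gt0_neq0 w : 0 < Im w -> w != 0.
Proof. by apply: contraTneq => ->; rewrite /= ltxx. Qed.

(** Ninv in a name refers to w |-> -1/w, a self-map of the upper half plane. *)
Lemma normc_Ninv w : normc (- (1 / w)) = (normc w)^-1.
Proof. by rewrite normcN div1r ComplexField.Normc.normcV. Qed.

Lemma Re_Ninv w : Re (- (1 / w)) = - (Re w * (Re w ^+ 2 + Im w ^+ 2)^-1).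
Proof. by rewrite div1r; case: w. Qed.

Lemma Im_Ninv w : Im (- (1 / w)) = Im w * (Re w ^+ 2 + Im w ^+ 2)^-1.
Proof. by rewrite div1r; case: w => a b /=; rewrite opprK. Qed.

Lemma Im_Ninv_normc w : Im (- (1 / w)) = normc (- (1 / w)) ^+ 2 * Im w.
Proof. by rewrite normc_Ninv exprVn sqr_normcE Im_Ninv mulrC. Qed.

Lemma normc_Ninv_le (eta : R) w : 0 < eta -> eta <= Im w ->
  normc (- (1 / w)) <= eta^-1.
Proof.
move=> e0 ew; have h := le_trans ew (le_trans (ler_norm _) (Im_le_normc _)).
by rewrite normc_Ninv lef_pV2 ?posrE// (lt_le_trans e0).
Qed.

Lemma Ninv_sub w1 w2 : w1 != 0 -> w2 != 0 ->
  - (1 / w1) - - (1 / w2) = (- (1 / w1)) * (- (1 / w2)) * (w1 - w2).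
Proof. by move=> ? ?; field; apply/andP. Qed.

Lemma normc_Ninv_sub w1 w2 : w1 != 0 -> w2 != 0 ->
  normc (- (1 / w1) - - (1 / w2)) =
  normc (- (1 / w1)) * normc (- (1 / w2)) * normc (w1 - w2).
Proof. by move=> ? ?; rewrite Ninv_sub// !ComplexField.Normc.normcM. Qed.

End ComplexModulus.

(** * Integrals of complex functions against a nonnegative weight *)

Section WeightedIntegrals.
Context d (T : measurableType d) (R : realType).
Variable mu : {measure set T -> \bar R}.
Implicit Types (f : T -> R) (g : T -> R[i]).
Local Notation normc := (@ComplexField.Normc.normc R).
Local Notation Re := (@complex.Re R).
Local Notation Im := (@complex.Im R).
Local Notation integrable f := (mu.-integrable setT (EFin \o f)).

Definition cmeasurable g : Prop :=
  measurable_fun setT (Re \o g) /\ measurable_fun setT (Im \o g).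

Lemma dominated_integrableR f (F : T -> R) : measurable_fun setT f ->
  (forall x, `|f x| <= F x) -> integrable F -> integrable f.
Proof.
move=> mf fF; apply: le_integrable => //; first exact/measurable_EFinP.
by move=> x _ /=; rewrite lee_fin (le_trans (fF x)) ?ler_norm.
Qed.

Lemma integrableZR a f : integrable f -> integrable (fun y => a * f y).
Proof. by move=> i; have := integrableZl measurableT a i. Qed.

Lemma integrableDR f1 f2 : integrable f1 -> integrable f2 ->
  integrable (fun y => f1 y + f2 y).
Proof. by move=> i1 i2; have := integrableD measurableT i1 i2. Qed.

Lemma measurable_sqrt f : measurable_fun setT f ->
  measurable_fun setT (fun x => Num.sqrt (f x)).
Proof.
move=> mf; apply: (measurableT_comp (f := @Num.sqrt R)) => //.
by apply: continuous_measurable_fun; exact: sqrt_continuous.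
Qed.

Lemma measurable_inv_ge0 f : (forall x, 0 <= f x) -> measurable_fun setT f ->
  measurable_fun setT (fun x => (f x)^-1).
Proof.
move=> f0 mf; rewrite (_ : (fun _ => _) = (fun x => f x `^ (-1))).
  by apply: (measurableT_comp (measurable_powR _)).
by apply/funext => x; rewrite powR_inv1.
Qed.

Lemma measurable_normc g : cmeasurable g -> measurable_fun setT (normc \o g).
Proof.
move=> [mr mi].
rewrite (_ : _ \o _ = fun x => Num.sqrt (Re (g x) ^+ 2 + Im (g x) ^+ 2)).
  by apply: measurable_sqrt; apply: measurable_funD; exact: measurable_funX.
by apply/funext => x /=; case: (g x).
Qed.

Lemma cmeasurableB g1 g2 : cmeasurable g1 -> cmeasurable g2 ->
  cmeasurable (fun x => g1 x - g2 x).
Proof.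
move=> [r1 i1] [r2 i2]; split.
  rewrite (_ : _ \o _ = (Re \o g1) \- (Re \o g2)); first exact: measurable_funB.
  by apply/funext => x /=; case: (g1 x); case: (g2 x).
rewrite (_ : _ \o _ = (Im \o g1) \- (Im \o g2)); first exact: measurable_funB.
by apply/funext => x /=; case: (g1 x); case: (g2 x).
Qed.

Lemma cmeasurableZ (a : R[i]) g : cmeasurable g -> cmeasurable (fun x => a * g x).
Proof.
move=> [r1 i1]; split.
  rewrite (_ : _ \o _ =
    (fun x => Re a * (Re \o g) x) \- (fun x => Im a * (Im \o g) x)).
    by apply: measurable_funB; exact: measurable_funM.
  by apply/funext => x /=; case: a => ? ?; case: (g x).
rewrite (_ : _ \o _ =
  (fun x => Re a * (Im \o g) x) \+ (fun x => Im a * (Re \o g) x)).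
  by apply: measurable_funD; exact: measurable_funM.
by apply/funext => x /=; case: a => ? ?; case: (g x) => ? ? /=; rewrite addrC.
Qed.

Lemma cmeasurable_Ninv g : cmeasurable g -> cmeasurable (fun x => - (1 / g x)).
Proof.
move=> [mr mi]; have mden : measurable_fun setT
    (fun x => (Re (g x) ^+ 2 + Im (g x) ^+ 2)^-1).
  apply: measurable_inv_ge0; first by move=> x; rewrite addr_ge0 ?sqr_ge0.
  by apply: measurable_funD; exact: measurable_funX.
split.
  rewrite (_ : _ \o _ = \- (fun x => Re (g x) *
    (Re (g x) ^+ 2 + Im (g x) ^+ 2)^-1)).
    by apply: measurable_funN; exact: measurable_funM.
  by apply/funext => x /=; rewrite Re_Ninv.
rewrite (_ : _ \o _ = fun x => Im (g x) *
    (Re (g x) ^+ 2 + Im (g x) ^+ 2)^-1).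
  exact: measurable_funM.
by apply/funext => x /=; rewrite Im_Ninv.
Qed.

Section Weight.
Variable w : T -> R.
Hypothesis mw : measurable_fun setT w.
Hypothesis w_ge0 : forall y, 0 <= w y.

Lemma integrable_weight f (F : T -> R) : measurable_fun setT f ->
  (forall y, `|f y| <= F y) -> integrable (fun y => w y * F y) ->
  integrable (fun y => w y * f y).
Proof.
move=> mf fF; apply: dominated_integrableR; first exact: measurable_funM.
by move=> y; rewrite normrM (ger0_norm (w_ge0 y)) ler_wpM2l.
Qed.

(** The weight is kept apart from g so that a row of a kernel can play its role. *)
Definition wcintegral g : R[i] := cintegral mu (fun y => (w y)%:C * g y).

Lemma wcintegralE g :
  wcintegral g = (\int[mu]_y (w y * Re (g y))) +i* (\int[mu]_y (w y * Im (g y))).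
Proof.
rewrite /wcintegral /cintegral; congr (_ +i* _); apply: eq_Rintegral => y _.
  by case: (g y) => a b /=; rewrite mul0r subr0.
by case: (g y) => a b /=; rewrite mul0r addr0.
Qed.

Lemma Re_wcintegral g : Re (wcintegral g) = \int[mu]_y (w y * Re (g y)).
Proof. by rewrite wcintegralE. Qed.

Lemma Im_wcintegral g : Im (wcintegral g) = \int[mu]_y (w y * Im (g y)).
Proof. by rewrite wcintegralE. Qed.

Lemma integrable_wRe g : cmeasurable g ->
  integrable (fun y => w y * normc (g y)) -> integrable (fun y => w y * Re (g y)).
Proof. by move=> [mr _]; apply: integrable_weight => // y; exact: Re_le_normc. Qed.

Lemma integrable_wIm g : cmeasurable g ->
  integrable (fun y => w y * normc (g y)) -> integrable (fun y => w y * Im (g y)).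
Proof. by move=> [_ mi]; apply: integrable_weight => // y; exact: Im_le_normc. Qed.

(** Pairing the integral I with its own conjugate reduces the bound to the real
    inequality a Re g + b Im g <= |a + ib| |g|. *)
Lemma normc_wcintegral_le g : cmeasurable g ->
  integrable (fun y => w y * normc (g y)) ->
  normc (wcintegral g) <= \int[mu]_y (w y * normc (g y)).
Proof.
move=> mg ig; set I := wcintegral g; set J := Rintegral _ _ _.
have ir := integrable_wRe mg ig; have ii := integrable_wIm mg ig.
have [->|I0] := eqVneq (normc I) 0.
  by apply: Rintegral_ge0 => y _; rewrite mulr_ge0 ?normc_ge0.
have Ip : 0 < normc I by rewrite lt_neqAle eq_sym I0 normc_ge0.
rewrite -(ler_pM2l Ip) -expr2 sqr_normcE Re_wcintegral Im_wcintegral.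
set a := Rintegral _ _ _; set b := Rintegral _ _ _.
have Ia : Re I = a by rewrite Re_wcintegral.
have Ib : Im I = b by rewrite Im_wcintegral.
have -> : a ^+ 2 + b ^+ 2 =
    \int[mu]_y (a * (w y * Re (g y)) + b * (w y * Im (g y))).
  rewrite RintegralD//; [|exact: integrableZR..].
  by rewrite !RintegralZl// !expr2.
rewrite /J -RintegralZl//; apply: le_Rintegral => //.
- by apply: integrableDR => //; exact: integrableZR.
- exact: integrableZR.
move=> y _; rewrite mulrCA (mulrCA b) -mulrDr (mulrCA (normc I)) ler_wpM2l//.
apply: le_trans (ler_norm _) _.
rewrite -(@ler_pXn2r _ 2)// ?nnegrE ?mulr_ge0 ?normc_ge0//.
rewrite exprMn !sqr_normcE Ia Ib real_normK ?num_real// -subr_ge0.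
rewrite [leRHS](_ : _ = (a * Im (g y) - b * Re (g y)) ^+ 2) ?sqr_ge0//.
by ring.
Qed.

Lemma wcintegralB g1 g2 : cmeasurable g1 -> cmeasurable g2 ->
  integrable (fun y => w y * normc (g1 y)) ->
  integrable (fun y => w y * normc (g2 y)) ->
  wcintegral (fun y => g1 y - g2 y) = wcintegral g1 - wcintegral g2.
Proof.
move=> m1 m2 i1 i2; rewrite !wcintegralE.
have E (a b c e : R) : (a +i* b) - (c +i* e) = (a - c) +i* (b - e) by [].
rewrite E; congr (_ +i* _).
  rewrite -RintegralB//; [|exact: integrable_wRe..].
  apply: eq_Rintegral => y _; rewrite -mulrBr; congr (_ * _).
  by case: (g1 y); case: (g2 y).
rewrite -RintegralB//; [|exact: integrable_wIm..].
apply: eq_Rintegral => y _; rewrite -mulrBr; congr (_ * _).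
by case: (g1 y); case: (g2 y).
Qed.

Lemma wcintegralZ (a : R[i]) g : cmeasurable g ->
  integrable (fun y => w y * normc (g y)) ->
  wcintegral (fun y => a * g y) = a * wcintegral g.
Proof.
move=> mg ig; have ir := integrable_wRe mg ig; have ii := integrable_wIm mg ig.
rewrite !wcintegralE; case: a => a b.
have E (c e : R) : (a +i* b) * (c +i* e) = (a * c - b * e) +i* (a * e + b * c).
  by [].
rewrite E -!RintegralZl//; congr (_ +i* _).
  rewrite -RintegralB//; [|exact: integrableZR..].
  by apply: eq_Rintegral => y _; case: (g y) => c e /=; ring.
rewrite -RintegralD//; [|exact: integrableZR..].
by apply: eq_Rintegral => y _; case: (g y) => c e /=; ring.
Qed.

(** Cauchy-Schwarz for the measure obtained from w mu by adding an atom of mass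
    eta, proved from 2 sqrt(v1 v2) <= t v1 + v2 / t with t the square root of
    the quotient of the two sides. *)
Lemma weighted_cauchy_schwarz (eta : R) (v1 v2 : T -> R) : 0 < eta ->
  measurable_fun setT v1 -> measurable_fun setT v2 ->
  (forall y, 0 <= v1 y) -> (forall y, 0 <= v2 y) ->
  integrable (fun y => w y * v1 y) -> integrable (fun y => w y * v2 y) ->
  integrable (fun y => w y * Num.sqrt (v1 y * v2 y)) /\
  eta + \int[mu]_y (w y * Num.sqrt (v1 y * v2 y)) <=
  Num.sqrt ((eta + \int[mu]_y (w y * v1 y)) * (eta + \int[mu]_y (w y * v2 y))).
Proof.
move=> eta0 m1 m2 v10 v20 i1 i2.
set A := eta + \int[mu]_y (w y * v1 y); set B := eta + \int[mu]_y (w y * v2 y).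
have A0 : 0 < A.
  by rewrite ltr_wpDr// Rintegral_ge0// => y _; rewrite mulr_ge0.
have B0 : 0 < B.
  by rewrite ltr_wpDr// Rintegral_ge0// => y _; rewrite mulr_ge0.
have young (t a b : R) : 0 < t -> 0 <= a -> 0 <= b ->
    Num.sqrt (a * b) <= t / 2 * a + (2 * t)^-1 * b.
  move=> t0 a0 b0; have h : 0 <= t / 2 * a + (2 * t)^-1 * b.
    by rewrite addr_ge0// mulr_ge0// ?divr_ge0 ?invr_ge0 ?mulr_ge0// ltW.
  rewrite -(@ler_pXn2r _ 2)// ?nnegrE ?sqrtr_ge0// sqr_sqrtr ?mulr_ge0//.
  rewrite -subr_ge0 (_ : _ - _ = (t / 2 * a - (2 * t)^-1 * b) ^+ 2) ?sqr_ge0//.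
  by field; rewrite gt_eqF.
have iY (t : R) :
    integrable (fun y => t / 2 * (w y * v1 y) + (2 * t)^-1 * (w y * v2 y)).
  by apply: integrableDR => //; exact: integrableZR.
have wY (t : R) y : 0 < t -> w y * Num.sqrt (v1 y * v2 y) <=
    t / 2 * (w y * v1 y) + (2 * t)^-1 * (w y * v2 y).
  move=> t0; rewrite mulrCA (mulrCA (2 * t)^-1) -mulrDr ler_wpM2l//.
  exact: young.
have iS : integrable (fun y => w y * Num.sqrt (v1 y * v2 y)).
  apply: (dominated_integrableR _ _ (iY 1)).
    by apply: measurable_funM => //; apply: measurable_sqrt; exact: measurable_funM.
  by move=> y; rewrite ger0_norm ?mulr_ge0 ?sqrtr_ge0//; exact: wY.
split=> //; pose t := Num.sqrt (B / A).
have t0 : 0 < t by rewrite sqrtr_gt0 divr_gt0.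
apply: (@le_trans _ _ (t / 2 * A + (2 * t)^-1 * B)).
  have -> : t / 2 * A + (2 * t)^-1 * B = (t / 2 * eta + (2 * t)^-1 * eta) +
      \int[mu]_y (t / 2 * (w y * v1 y) + (2 * t)^-1 * (w y * v2 y)).
    rewrite RintegralD//; [|exact: integrableZR..].
    by rewrite !RintegralZl// /A /B; ring.
  apply: lerD.
    by have := young _ _ _ t0 (ltW eta0) (ltW eta0); rewrite -expr2 sqrtr_sqr gtr0_norm.
  by apply: le_Rintegral => // y _; exact: wY.
have tE : t ^+ 2 = B / A by rewrite sqr_sqrtr// divr_ge0 ?ltW.
have BE : B = t ^+ 2 * A by rewrite tE divfK ?gt_eqF.
have -> : A * B = (t * A) ^+ 2 by rewrite BE; ring.
rewrite sqrtr_sqr gtr0_norm ?mulr_gt0//.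
have -> : (2 * t)^-1 * B = t / 2 * A by rewrite BE; field; rewrite gt_eqF.
by rewrite -mulrDl -splitr.
Qed.

End Weight.
End WeightedIntegrals.

(** * Sequences with geometrically decaying increments *)

Section GeometricLimits.
Variable R : realType.
Local Notation normc := (@ComplexField.Normc.normc R).
Local Notation Re := (@complex.Re R).
Local Notation Im := (@complex.Im R).

Lemma cvg_mul_geometric (c l : R) : 0 <= l < 1 -> c * l ^+ n @[n --> \oo] --> (0 : R).
Proof.
move=> /andP[l0 l1]; rewrite -[X in _ --> X](mulr0 c).
by apply: cvgMr; apply: cvg_expr; rewrite ger0_norm.
Qed.

Lemma le_of_geometric_error (a b c l : R) : 0 <= l < 1 ->
  (forall n, a <= b + c * l ^+ n) -> a <= b.
Proof.
move=> l01 h; have cv : (fun n => b + c * l ^+ n) @ \oo --> b.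
  rewrite -[X in _ --> X](addr0 b).
  by apply: cvgD; [exact: cvg_cst|exact: cvg_mul_geometric].
rewrite -(cvg_lim _ cv)//; apply: limr_ge; first by apply/cvg_ex; exists b.
by near=> n; exact: h.
Unshelve. all: by end_near. Qed.

Lemma cvg_of_geometric_error (u : nat -> R) a c l : 0 <= l < 1 ->
  (forall n, `|u n - a| <= c * l ^+ n) -> u n @[n --> \oo] --> a.
Proof.
move=> l01 h; apply/cvgrPdist_le => e e0.
have /cvgrPdist_le/(_ e e0) := cvg_mul_geometric c l01.
apply: filterS => n; rewrite /= sub0r normrN => H.
by rewrite distrC (le_trans (h n))// (le_trans (ler_norm _)).
Qed.

Lemma geometric_increments_bound (u : nat -> R) c l n m : 0 <= l < 1 -> 0 <= c ->
  (forall n, `|u n.+1 - u n| <= c * l ^+ n) ->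
  `|u (n + m)%N - u n| <= c / (1 - l) * l ^+ n.
Proof.
move=> /andP[l0 l1] c0 h; have l1' : 0 < 1 - l by rewrite subr_gt0.
have : `|u (n + m)%N - u n| <= c / (1 - l) * l ^+ n * (1 - l ^+ m).
  elim: m => [|m IH]; first by rewrite addn0 subrr normr0 expr0 subrr mulr0.
  rewrite addnS -[_ - _](subrKA (u (n + m)%N)).
  apply: (le_trans (ler_normD _ _)); apply: (le_trans (lerD (h _) IH)).
  rewrite -subr_ge0 exprD exprS le_eqVlt; apply/orP; left; apply/eqP.
  by field; rewrite gt_eqF.
move=> /le_trans; apply; rewrite ler_piMr//.
  by rewrite mulr_ge0 ?exprn_ge0// divr_ge0// ltW.
by rewrite gerBl exprn_ge0.
Qed.

Lemma geometric_increments_limit (u : nat -> R) c l : 0 <= l < 1 -> 0 <= c ->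
  (forall n, `|u n.+1 - u n| <= c * l ^+ n) ->
  forall n, `|u n - limn u| <= c / (1 - l) * l ^+ n.
Proof.
move=> l01 c0 h; have B n m := geometric_increments_bound n m l01 c0 h.
have cu : cvgn u.
  apply/cauchy_cvgP/cauchy_exP => e e0.
  have /cvgrPdist_lt/(_ e e0)[N _ HN] := cvg_mul_geometric (c / (1 - l)) l01.
  exists (u N); exists N => // n /= Nn; rewrite /ball/= distrC -(subnKC Nn).
  apply: (le_lt_trans (B _ _)); have := HN N (leqnn N).
  by rewrite /= sub0r normrN; apply: le_lt_trans; exact: ler_norm.
move=> n; have cn : (fun m => `|u n - u (m + n)%N|) @ \oo --> `|u n - limn u|.
  apply: cvg_norm; apply: cvgB; first exact: cvg_cst.
  by rewrite (cvg_shiftn n u).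
rewrite -(cvg_lim _ cn)//; apply: limr_le; first by apply/cvg_ex; eexists; exact: cn.
by near=> m; rewrite distrC addnC; exact: B.
Unshelve. all: by end_near. Qed.

Context d (T : measurableType d).

Lemma geometric_limit_fun (u : nat -> T -> R[i]) (c : T -> R) l : 0 <= l < 1 ->
  (forall n, cmeasurable (u n)) ->
  (forall n x, normc (u n.+1 x - u n x) <= c x * l ^+ n) ->
  exists2 g, cmeasurable g &
    forall n x, normc (u n x - g x) <= 2 * (c x / (1 - l)) * l ^+ n.
Proof.
move=> l01 mu h.
have c0 x : 0 <= c x.
  by have := h 0%N x; rewrite expr0 mulr1; exact/le_trans/normc_ge0.
pose ur n x := Re (u n x); pose ui n x := Im (u n x).
have hr x n : `|ur n.+1 x - ur n x| <= c x * l ^+ n.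
  apply: le_trans (h n x); apply: le_trans (Re_le_normc _).
  by rewrite /ur; case: (u n.+1 x); case: (u n x).
have hi x n : `|ui n.+1 x - ui n x| <= c x * l ^+ n.
  apply: le_trans (h n x); apply: le_trans (Im_le_normc _).
  by rewrite /ui; case: (u n.+1 x); case: (u n x).
have lr x := geometric_increments_limit l01 (c0 x) (hr x).
have li x := geometric_increments_limit l01 (c0 x) (hi x).
exists (fun x => (limn (ur ^~ x)) +i* (limn (ui ^~ x))).
  split.
    apply: (@measurable_fun_cvg _ _ _ _ ur) => [n|x _]; first by case: (mu n).
    exact: (cvg_of_geometric_error l01 (lr x)).
  apply: (@measurable_fun_cvg _ _ _ _ ui) => [n|x _]; first by case: (mu n).
  exact: (cvg_of_geometric_error l01 (li x)).
move=> n x; apply: (le_trans (normc_le_ReIm _)).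
rewrite -mulrA mulr_natl mulr2n; apply: lerD.
  by have := lr x n; rewrite /ur; case: (u n x).
by have := li x n; rewrite /ui; case: (u n x).
Qed.

End GeometricLimits.

(** * The barrier contraction *)

Section Kernel.
Context d (T : measurableType d) (R : realType).
Variable mu : {finite_measure set T -> \bar R}.
Implicit Types (k : T -> T -> R) (z : R[i]) (g : T -> R[i]) (rho : T -> R).
Local Notation normc := (@ComplexField.Normc.normc R).
Local Notation Re := (@complex.Re R).
Local Notation Im := (@complex.Im R).
Local Notation integrable f := (mu.-integrable setT (EFin \o f)).

Definition kernel_op k g x : R[i] := wcintegral mu (k x) g.

Definition qve_map k z g x : R[i] := - (1 / (z + kernel_op k g x)).

(** The bound is stated for extended reals: it then includes the integrability of
    each k x * rho. *)
Definition sublinear_weight k (kappa : R) rho (C : R) : Prop :=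
  [/\ measurable_fun setT rho, forall x, 1 <= rho x,
      integrable (fun x => rho x ^+ 2), 0 <= C &
      forall x, (\int[mu]_y (k x y * rho y)%:E <= (kappa * rho x + C)%:E)%E].

(** What the argument uses of a square integrable kernel, with properties that
    hold at every point and not only almost everywhere. *)
Definition tame_kernel k : Prop :=
  [/\ measurable_fun setT (fun p : T * T => k p.1 p.2),
      forall x y, 0 <= k x y &
      forall kappa, 0 < kappa -> exists rho C, sublinear_weight k kappa rho C].

Definition half_disk_fun (eta : R) g : Prop :=
  cmeasurable g /\ forall x, 0 <= Im (g x) /\ normc (g x) <= eta^-1.

Section FixedKernel.
Variable k : T -> T -> R.
Hypothesis mk : measurable_fun setT (fun p : T * T => k p.1 p.2).
Hypothesis k_ge0 : forall x y, 0 <= k x y.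
Variables (eta : R) (eta_gt0 : 0 < eta).
Variables (rho : T -> R) (C : R).
Hypothesis wrho : sublinear_weight k (eta ^+ 2 / 2) rho C.

Let mrho : measurable_fun setT rho. Proof. by case: wrho. Qed.
Let rho_ge1 x : 1 <= rho x. Proof. by case: wrho. Qed.
Let rho_ge0 x : 0 <= rho x. Proof. exact: le_trans ler01 (rho_ge1 x). Qed.
Let C_ge0 : 0 <= C. Proof. by case: wrho. Qed.
Let etaV_ge0 : 0 <= eta^-1. Proof. by rewrite invr_ge0 ltW. Qed.

Lemma measurable_kernel_section x : measurable_fun setT (k x).
Proof. exact: (measurable_fun_pair2 x mk). Qed.
Let mkx := measurable_kernel_section.

Lemma integrable_kernel_rho x : integrable (fun y => k x y * rho y).
Proof.
apply/integrableP; split.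
  by apply/measurable_EFinP; exact: measurable_funM.
case: wrho => _ _ _ _ /(_ x) h; apply: le_lt_trans (ltry (eta ^+ 2 / 2 * rho x + C)).
apply: le_trans h; rewrite le_eqVlt; apply/orP; left; apply/eqP.
by apply: eq_integral => y _ /=; rewrite ger0_norm// mulr_ge0.
Qed.

Lemma kernel_rho_le x : \int[mu]_y (k x y * rho y) <= eta ^+ 2 / 2 * rho x + C.
Proof.
case: wrho => _ _ _ _ /(_ x) h.
rewrite -lee_fin /Rintegral fineK//.
by have := integrable_fin_num measurableT (integrable_kernel_rho x).
Qed.

Lemma integrable_kernel x (f : T -> R) c : measurable_fun setT f ->
  (forall y, `|f y| <= c * rho y) -> integrable (fun y => k x y * f y).
Proof.
move=> mf fc; apply: (integrable_weight (mkx x) (k_ge0 x) mf fc).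
have := integrableZR c (integrable_kernel_rho x).
by under eq_fun do rewrite mulrCA.
Qed.

Lemma integrable_kernel_bounded x (f : T -> R) c : measurable_fun setT f ->
  (forall y, `|f y| <= c) -> integrable (fun y => k x y * f y).
Proof.
move=> mf fc; apply: (@integrable_kernel _ _ (c)) => // y.
apply: (le_trans (fc y)); rewrite ler_peMr//.
exact: le_trans (normr_ge0 _) (fc y).
Qed.

Lemma integrable_rho : integrable rho.
Proof.
case: wrho => _ _ i2 _ _; apply: dominated_integrableR i2 => // x.
by rewrite ger0_norm// expr2 ler_peMr.
Qed.

(** Fubini applies because |k x y f y| <= c k x y rho y, whose integral in y is at
    most a multiple of the integrable function kappa rho + C. *)
Lemma measurable_kernel_integral (f : T -> R) c : measurable_fun setT f ->
  (forall y, `|f y| <= c) -> measurable_fun setT (fun x => \int[mu]_y (k x y * f y)).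
Proof.
move=> mf fc.
have c0 : T -> 0 <= c by move=> x; exact: le_trans (normr_ge0 _) (fc x).
pose F (p : T * T) := (k p.1 p.2 * f p.2)%:E.
have mF : measurable_fun setT F.
  apply/measurable_EFinP; apply: measurable_funM => //.
  exact: (measurableT_comp mf measurable_snd).
have iF : (mu \x mu)%E.-integrable setT F.
  apply/(integrable12ltyP _ _ mF).
  have mH : measurable_fun setT (fun x => (c * (eta ^+ 2 / 2 * rho x + C))%:E).
    apply/measurable_EFinP; apply: measurable_funM => //.
    by apply: measurable_funD => //; exact: measurable_funM.
  apply: (@le_lt_trans _ _ (\int[mu]_x (c * (eta ^+ 2 / 2 * rho x + C))%:E)%E).
    apply: ge0_le_integral => //.
    - by move=> x _; exact: integral_ge0.
    - apply: (@measurable_fun_fubini_tonelli_F _ _ _ _ _ mu (fun p => `|F p|%E)) => //.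
      exact: measurableT_comp.
    move=> x _; apply: (@le_trans _ _ (\int[mu]_y (c * (k x y * rho y))%:E)%E).
      apply: ge0_le_integral => //.
      - apply: measurableT_comp => //.
        exact: (measurable_fun_pair2 x mF).
      - apply/measurable_EFinP; apply: measurable_funM; first exact: measurable_cst.
        exact: (measurable_funM (mkx x) mrho).
      move=> y _; rewrite /F /= lee_fin normrM ger0_norm// mulrCA ler_wpM2l//.
      by rewrite (le_trans (fc y))// ler_peMr// c0.
    under eq_integral do rewrite EFinM.
    rewrite integralZl//; last exact: integrable_kernel_rho.
    by rewrite EFinM lee_wpmul2l ?lee_fin ?c0//; case: wrho.
  have iH : integrable (fun x => c * (eta ^+ 2 / 2 * rho x + C)).
    apply: integrableZR; apply: integrableDR; first exact: integrableZR integrable_rho.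
    exact: finite_measure_integrable_cst.
  exact: integrable_lty iH.
rewrite /Rintegral; apply: (measurableT_comp (fine_measurable measurableT)).
exact: measurable_fubini_F iF.
Qed.

Lemma cmeasurable_kernel_op g c : cmeasurable g -> (forall x, normc (g x) <= c) ->
  cmeasurable (kernel_op k g).
Proof.
move=> [mr mi] gc; split.
  rewrite (_ : _ \o _ = fun x => \int[mu]_y (k x y * Re (g y))).
    apply: (@measurable_kernel_integral _ c mr) => y.
    exact: le_trans (Re_le_normc _) (gc y).
  by apply/funext => x; exact: Re_wcintegral.
rewrite (_ : _ \o _ = fun x => \int[mu]_y (k x y * Im (g y))).
  apply: (@measurable_kernel_integral _ c mi) => y.
  exact: le_trans (Im_le_normc _) (gc y).
by apply/funext => x; exact: Im_wcintegral.
Qed.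

Lemma integrable_kernel_normc x g c : cmeasurable g -> (forall y, normc (g y) <= c) ->
  integrable (fun y => k x y * normc (g y)).
Proof.
move=> mg gc; apply: (@integrable_kernel_bounded _ _ (c)).
  exact: measurable_normc.
by move=> y; rewrite ger0_norm ?normc_ge0.
Qed.

Lemma Im_kernel_op_ge0 g x : (forall y, 0 <= Im (g y)) -> 0 <= Im (kernel_op k g x).
Proof.
by move=> g0; rewrite /kernel_op Im_wcintegral Rintegral_ge0// => y _; rewrite mulr_ge0.
Qed.

Lemma Im_argument_ge z g x : eta <= Im z -> half_disk_fun eta g ->
  eta <= Im (z + kernel_op k g x).
Proof.
move=> ez [_ gb]; rewrite ImD (le_trans ez)// lerDl Im_kernel_op_ge0// => y.
by case: (gb y).
Qed.

Lemma argument_neq0 z g x : eta <= Im z -> half_disk_fun eta g ->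
  z + kernel_op k g x != 0.
Proof.
move=> ez gb; apply: Im_gt0_neq0.
exact: lt_le_trans eta_gt0 (Im_argument_ge x ez gb).
Qed.

Lemma normc_qve_map_le z g x : eta <= Im z -> half_disk_fun eta g ->
  normc (qve_map k z g x) <= eta^-1.
Proof.
by move=> ez gb; apply: normc_Ninv_le (Im_argument_ge x ez gb).
Qed.

Lemma Im_qve_map_gt0 z g x : eta <= Im z -> half_disk_fun eta g ->
  0 < Im (qve_map k z g x).
Proof.
move=> ez gb; have h := Im_argument_ge x ez gb.
have h' := le_trans h (le_trans (ler_norm _) (Im_le_normc _)).
rewrite Im_Ninv_normc mulr_gt0 ?(lt_le_trans eta_gt0 h)//.
by rewrite exprn_gt0// normc_Ninv invr_gt0 (lt_le_trans eta_gt0).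
Qed.

Lemma half_disk_fun_qve_map z g : eta <= Im z -> half_disk_fun eta g ->
  half_disk_fun eta (qve_map k z g).
Proof.
move=> ez gb; split; last first.
  by move=> x; rewrite ltW ?Im_qve_map_gt0//; split => //; exact: normc_qve_map_le.
apply: cmeasurable_Ninv; have [mr mi] : cmeasurable (kernel_op k g).
  case: gb => mg gb.
  by apply: (@cmeasurable_kernel_op _ (eta^-1)) => // x; case: (gb x).
split.
  rewrite (_ : _ \o _ = fun x => Re z + (Re \o kernel_op k g) x).
    exact: measurable_funD.
  by apply/funext => x; exact: ReD.
rewrite (_ : _ \o _ = fun x => Im z + (Im \o kernel_op k g) x).
  exact: measurable_funD.
by apply/funext => x; exact: ImD.
Qed.

Lemma normc_qve_map_sub_le z1 z2 g1 g2 x : eta <= Im z1 -> eta <= Im z2 ->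
  half_disk_fun eta g1 -> half_disk_fun eta g2 ->
  normc (qve_map k z1 g1 x - qve_map k z2 g2 x) <=
  normc (qve_map k z1 g1 x) * normc (qve_map k z2 g2 x) *
    (normc (z1 - z2) + \int[mu]_y (k x y * normc (g1 y - g2 y))).
Proof.
move=> e1 e2 b1 b2; rewrite /qve_map normc_Ninv_sub; [|exact: argument_neq0..].
rewrite ler_wpM2l ?mulr_ge0 ?normc_ge0//.
have [[m1 n1] [m2 n2]] := (b1, b2).
have N1 y : normc (g1 y) <= eta^-1 by case: (n1 y).
have N2 y : normc (g2 y) <= eta^-1 by case: (n2 y).
have -> : z1 + kernel_op k g1 x - (z2 + kernel_op k g2 x) =
    z1 - z2 + wcintegral mu (k x) (fun y => g1 y - g2 y).
  rewrite wcintegralB//; [|exact: integrable_kernel_normc N1|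
    exact: integrable_kernel_normc N2].
  by rewrite addrACA opprD.
apply: (le_trans (le_normcD _ _)); rewrite lerD2l normc_wcintegral_le//.
  exact: cmeasurableB.
apply: (@integrable_kernel_normc _ _ (eta^-1 + eta^-1)); first exact: cmeasurableB.
by move=> y; rewrite (le_trans (normc_leB _ _))// lerD.
Qed.

Definition geom_mean_Im g1 g2 (x : T) : R := Num.sqrt (Im (g1 x) * Im (g2 x)).

Lemma geom_mean_Im_ge0 g1 g2 x : 0 <= geom_mean_Im g1 g2 x.
Proof. exact: sqrtr_ge0. Qed.

Lemma geom_mean_Im_le g1 g2 x : half_disk_fun eta g1 ->
  half_disk_fun eta g2 -> geom_mean_Im g1 g2 x <= eta^-1.
Proof.
move=> [_ /(_ x)[p1 n1]] [_ /(_ x)[p2 n2]].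
have v1 := le_trans (ler_norm _) (le_trans (Im_le_normc _) n1).
have v2 := le_trans (ler_norm _) (le_trans (Im_le_normc _) n2).
rewrite -(ger0_norm etaV_ge0) -sqrtr_sqr ler_wsqrtr// expr2.
exact: ler_pM.
Qed.

Lemma measurable_geom_mean_Im g1 g2 : cmeasurable g1 -> cmeasurable g2 ->
  measurable_fun setT (geom_mean_Im g1 g2).
Proof.
by move=> [_ m1] [_ m2]; apply: measurable_sqrt; exact: measurable_funM.
Qed.

(** The supersolution given by the imaginary parts: Im(-1/w) = |1/w|^2 Im w, and
    Cauchy-Schwarz compares the integral of the geometric mean with the geometric
    mean of the integrals. *)
Lemma geom_mean_Im_supersolution z1 z2 g1 g2 x : eta <= Im z1 -> eta <= Im z2 ->
  half_disk_fun eta g1 -> half_disk_fun eta g2 ->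
  normc (qve_map k z1 g1 x) * normc (qve_map k z2 g2 x) *
    (eta + \int[mu]_y (k x y * geom_mean_Im g1 g2 y)) <=
  geom_mean_Im (qve_map k z1 g1) (qve_map k z2 g2) x.
Proof.
move=> e1 e2 b1 b2.
have [[[_ m1] n1] [[_ m2] n2]] := (b1, b2).
have i1 : integrable (fun y => k x y * Im (g1 y)).
  apply: (@integrable_kernel_bounded _ _ (eta^-1)) => // y.
  by case: (n1 y) => _; exact/le_trans/Im_le_normc.
have i2 : integrable (fun y => k x y * Im (g2 y)).
  apply: (@integrable_kernel_bounded _ _ (eta^-1)) => // y.
  by case: (n2 y) => _; exact/le_trans/Im_le_normc.
have [_ CS] := weighted_cauchy_schwarz (mkx x) (k_ge0 x) eta_gt0 m1 m2
  (fun y => (n1 y).1) (fun y => (n2 y).1) i1 i2.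
rewrite /geom_mean_Im /qve_map !Im_Ninv_normc.
set N1 := normc _; set N2 := normc _.
rewrite mulrACA -exprMn sqrtrM ?sqr_ge0// sqrtr_sqr ger0_norm ?mulr_ge0 ?normc_ge0//.
rewrite ler_wpM2l ?mulr_ge0 ?normc_ge0//; apply: (le_trans CS).
rewrite ler_wsqrtr// !ImD /kernel_op !Im_wcintegral.
have p1 : 0 <= \int[mu]_y (k x y * Im (g1 y)).
  by apply: Rintegral_ge0 => y _; rewrite mulr_ge0//; case: (n1 y).
have p2 : 0 <= \int[mu]_y (k x y * Im (g2 y)).
  by apply: Rintegral_ge0 => y _; rewrite mulr_ge0//; case: (n2 y).
by rewrite ler_pM ?lerD// addr_ge0// ltW.
Qed.

(** The coefficient of rho in the barrier: its product with the constant C of the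
    weight is at most eta, the gain of the supersolution. *)
Definition rho_coef : R := eta / (C + 1).

(** The second bound gives gap / eta <= rho_coef / 4, so that a multiple of rho
    absorbs gap times the geometric mean of the imaginary parts. *)
Definition gap : R := Num.min (1 / 4) (eta * rho_coef / 4).

Lemma rho_coef_gt0 : 0 < rho_coef.
Proof. by rewrite divr_gt0// ltr_wpDl. Qed.

Lemma gap_gt0 : 0 < gap.
Proof. by rewrite lt_min !divr_gt0// mulr_gt0 ?rho_coef_gt0. Qed.

Lemma gap_le : gap <= 1 / 4. Proof. by rewrite ge_min lexx. Qed.

Lemma onem_gap01 : 0 <= 1 - gap < 1.
Proof. by have := gap_le; have := gap_gt0; lra. Qed.

Definition barrier g1 g2 (x : T) : R := rho_coef * rho x + geom_mean_Im g1 g2 x.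

Lemma barrier_ge g1 g2 x : rho_coef <= barrier g1 g2 x.
Proof.
apply: (@le_trans _ _ (rho_coef * rho x)).
  by rewrite ler_peMr// ltW// rho_coef_gt0.
by rewrite lerDl geom_mean_Im_ge0.
Qed.

Lemma barrier_ge0 g1 g2 x : 0 <= barrier g1 g2 x.
Proof. exact: le_trans (ltW rho_coef_gt0) (barrier_ge _ _ _). Qed.

Lemma barrier_le g1 g2 x : half_disk_fun eta g1 ->
  half_disk_fun eta g2 -> barrier g1 g2 x <= (rho_coef + eta^-1) * rho x.
Proof.
move=> b1 b2; rewrite mulrDl lerD2l; apply: (le_trans (geom_mean_Im_le x b1 b2)).
by rewrite ler_peMr.
Qed.

Lemma measurable_barrier g1 g2 : cmeasurable g1 -> cmeasurable g2 ->
  measurable_fun setT (barrier g1 g2).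
Proof.
move=> m1 m2; apply: measurable_funD; first exact: measurable_funM.
exact: measurable_geom_mean_Im.
Qed.

(** The geometric mean of imaginary parts is a supersolution with a gain of eta
    times the product of the moduli of the two images; this gain pays for the
    constant C in the bound on the integral of rho, while rho, being bounded below,
    pays for making the supersolution strict by the factor 1 - gap. *)
Lemma barrier_contraction z1 z2 g1 g2 x : eta <= Im z1 -> eta <= Im z2 ->
  half_disk_fun eta g1 -> half_disk_fun eta g2 ->
  normc (qve_map k z1 g1 x) * normc (qve_map k z2 g2 x) *
    \int[mu]_y (k x y * barrier g1 g2 y) <=
  (1 - gap) * barrier (qve_map k z1 g1) (qve_map k z2 g2) x.
Proof.
move=> e1 e2 b1 b2; have [[m1 _] [m2 _]] := (b1, b2).
have sup := geom_mean_Im_supersolution x e1 e2 b1 b2.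
have G1 := half_disk_fun_qve_map e1 b1; have G2 := half_disk_fun_qve_map e2 b2.
have Ele := geom_mean_Im_le x G1 G2.
have := normc_qve_map_le x e1 b1; have := normc_qve_map_le x e2 b2.
have := normc_ge0 (qve_map k z1 g1 x); have := normc_ge0 (qve_map k z2 g2 x).
rewrite /barrier.
set E := geom_mean_Im (qve_map _ _ _) _ _ in sup Ele *.
set n1 := normc _ in sup *; set n2 := normc (qve_map k z2 g2 x) in sup *.
move=> n20 n10 n2e n1e.
have ir := integrableZR rho_coef (integrable_kernel_rho x).
have ie : integrable (fun y => k x y * geom_mean_Im g1 g2 y).
  apply: (@integrable_kernel_bounded _ _ (eta^-1)).
    exact: measurable_geom_mean_Im.
  by move=> y; rewrite ger0_norm ?geom_mean_Im_ge0// geom_mean_Im_le.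
have -> : \int[mu]_y (k x y * (rho_coef * rho y + geom_mean_Im g1 g2 y)) =
    rho_coef * \int[mu]_y (k x y * rho y) +
    \int[mu]_y (k x y * geom_mean_Im g1 g2 y).
  rewrite -RintegralZl//; last exact: integrable_kernel_rho.
  by rewrite -RintegralD//; apply: eq_Rintegral => y _; rewrite mulrDr mulrCA.
have Kr := kernel_rho_le x.
set Ir := Rintegral _ _ _ in Kr *; set Ie := Rintegral _ _ _ in sup *.
have m0 : 0 <= n1 * n2 by rewrite mulr_ge0.
have m1e : n1 * n2 * eta ^+ 2 <= 1.
  have : n1 * n2 <= eta^-1 * eta^-1 by exact: ler_pM.
  rewrite -(@ler_pM2r _ (eta ^+ 2)) ?exprn_gt0// => /le_trans; apply.
  by rewrite expr2 mulrACA mulVf ?gt_eqF// mulr1.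
(* eta n1 n2 is the gain of the supersolution; it absorbs rho_coef C n1 n2. *)
have aC : rho_coef * C <= eta.
  by rewrite /rho_coef mulrAC ler_pdivrMr ?ltr_wpDl// ler_pM2l// lerDl.
have a0 := rho_coef_gt0.
have ar : rho_coef <= rho_coef * rho x by rewrite ler_peMr// ltW.
have E0 : 0 <= E by exact: geom_mean_Im_ge0.
have epsE : gap * E <= rho_coef / 4.
  apply: (@le_trans _ _ (gap * eta^-1)); first by rewrite ler_wpM2l// ltW// gap_gt0.
  by rewrite ler_pdivrMr// mulrC mulrA ge_min lexx orbT.
have h1 : n1 * n2 * (rho_coef * Ir) <= rho_coef * rho x / 2 + n1 * n2 * eta.
  apply: (@le_trans _ _ (n1 * n2 * (rho_coef * (eta ^+ 2 / 2 * rho x + C)))).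
    by rewrite ler_wpM2l// ler_wpM2l// ltW.
  have -> : n1 * n2 * (rho_coef * (eta ^+ 2 / 2 * rho x + C)) =
     (rho_coef * rho x / 2) * (n1 * n2 * eta ^+ 2) + n1 * n2 * (rho_coef * C) by field.
  apply: lerD; last by rewrite ler_wpM2l.
  by rewrite ler_piMr// divr_ge0// (le_trans (ltW a0)).
have epsr : gap * (rho_coef * rho x) <= 1 / 4 * (rho_coef * rho x).
  by rewrite ler_wpM2r ?gap_le// (le_trans (ltW a0)).
rewrite !mulrDr in sup *; lra.
Qed.

Lemma barrier_step z1 z2 g1 g2 (q : T -> R) b x : eta <= Im z1 -> eta <= Im z2 ->
  half_disk_fun eta g1 -> half_disk_fun eta g2 ->
  measurable_fun setT q -> (forall y, 0 <= q y <= b * barrier g1 g2 y) ->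
  normc (qve_map k z1 g1 x) * normc (qve_map k z2 g2 x) * \int[mu]_y (k x y * q y) <=
  (1 - gap) * b * barrier (qve_map k z1 g1) (qve_map k z2 g2) x.
Proof.
move=> e1 e2 b1 b2 mq qb; have [[m1 _] [m2 _]] := (b1, b2).
have b0 : 0 <= b.
  have /andP[q0 qx] := qb x; rewrite -(@pmulr_lge0 _ (barrier g1 g2 x)).
    exact: le_trans q0 qx.
  exact: lt_le_trans rho_coef_gt0 (barrier_ge _ _ _).
have iB : integrable (fun y => k x y * barrier g1 g2 y).
  apply: (@integrable_kernel _ _ (rho_coef + eta^-1)); first exact: measurable_barrier.
  by move=> y; rewrite ger0_norm ?barrier_ge0// barrier_le.
have ibB := integrableZR b iB.
have iq : integrable (fun y => k x y * q y).
  apply: dominated_integrableR ibB.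
    by apply: measurable_funM => //; exact: mkx.
  move=> y; have /andP[q0 qx] := qb y.
  by rewrite ger0_norm ?mulr_ge0// mulrCA ler_wpM2l.
rewrite (mulrAC (1 - gap)) (mulrC _ b).
apply: le_trans (ler_wpM2l b0 (barrier_contraction x e1 e2 b1 b2)).
rewrite mulrCA ler_wpM2l ?mulr_ge0 ?normc_ge0// -RintegralZl//.
apply: le_Rintegral => // y _; have /andP[_ qx] := qb y.
by rewrite mulrCA ler_wpM2l.
Qed.

(** * Existence, comparison and uniqueness *)

Lemma normc_sub_barrier g1 g2 x : half_disk_fun eta g1 ->
  half_disk_fun eta g2 ->
  normc (g1 x - g2 x) <= 2 * eta^-1 / rho_coef * barrier g1 g2 x.
Proof.
move=> [_ /(_ x)[_ h1]] [_ /(_ x)[_ h2]].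
apply: (le_trans (normc_leB _ _)); apply: (le_trans (lerD h1 h2)).
rewrite (_ : eta^-1 + eta^-1 = 2 * eta^-1 / rho_coef * rho_coef).
  apply: ler_wpM2l (barrier_ge _ _ _); apply: divr_ge0; first exact: mulr_ge0.
  exact: ltW rho_coef_gt0.
by rewrite divfK ?gt_eqF ?rho_coef_gt0// mulr_natl mulr2n.
Qed.

(** Picard iteration from the constant i / eta: the increments decay geometrically
    in the norm weighted by the barrier, hence pointwise at a rate proportional to
    rho. The rate also bounds the defect of the limit in the equation, because k x
    is integrable against rho. *)
Lemma solution_exists z : eta <= Im z ->
  exists g, half_disk_fun eta g /\ g = qve_map k z g.
Proof.
move=> ez; pose u := fix u n := if n is n'.+1 then qve_map k z (u n') else
  fun _ : T => 0 +i* eta^-1.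
have ub n : half_disk_fun eta (u n).
  elim: n => [|n IH]; last exact: half_disk_fun_qve_map.
  split; first by split; exact: measurable_cst.
  by move=> x /=; split => //; rewrite expr0n /= add0r sqrtr_sqr ger0_norm.
have a0 := rho_coef_gt0; have e0 := gap_gt0.
pose B := 2 * eta^-1 / rho_coef.
have B0 : 0 <= B by apply: divr_ge0; [exact: mulr_ge0|exact: ltW].
have incr n x : normc (u n.+1 x - u n x) <=
    (1 - gap) ^+ n * B * barrier (u n.+1) (u n) x.
  elim: n x => [|n IH] x.
    by rewrite expr0 mul1r; exact: normc_sub_barrier (ub 1%N) (ub 0%N).
  apply: le_trans (normc_qve_map_sub_le x ez ez (ub n.+1) (ub n)) _.
  rewrite subrr ComplexField.Normc.normc0 add0r exprS -(mulrA (1 - gap)).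
  apply: barrier_step => //.
    by apply: measurable_normc; apply: cmeasurableB; [case: (ub n.+1)|case: (ub n)].
  by move=> y; rewrite normc_ge0 IH.
have incr' n x : normc (u n.+1 x - u n x) <=
    B * ((rho_coef + eta^-1) * rho x) * (1 - gap) ^+ n.
  apply: (le_trans (incr n x)); rewrite mulrC mulrA (mulrAC _ _ B).
  rewrite ler_wpM2r ?exprn_ge0//; first by case/andP: onem_gap01.
  by rewrite mulrC ler_wpM2l// barrier_le.
have [g mg gu] := geometric_limit_fun onem_gap01 (fun n => (ub n).1) incr'.
set K := fun x => 2 * (B * ((rho_coef + eta^-1) * rho x) / (1 - (1 - gap))).
have gb : half_disk_fun eta g.
  split=> // x; split.
    rewrite -oppr_le0; apply: (le_of_geometric_error onem_gap01 (c := K x)) => n.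
    have [_ /(_ x)[h _]] := ub n; rewrite add0r; apply: le_trans (gu n x).
    apply: le_trans (Im_le_normc _); apply: le_trans (ler_norm _).
    by rewrite ImD (_ : Im (- g x) = - Im (g x)) ?lerDr//; case: (g x).
  apply: (le_of_geometric_error onem_gap01 (c := K x)) => n.
  have [_ /(_ x)[_ h]] := ub n; rewrite -[g x](subKr (u n x)).
  by apply: (le_trans (normc_leB _ _)); rewrite lerD.
exists g; split => //; apply/funext => x; apply/eqP; rewrite -subr_eq0.
apply/eqP/ComplexField.Normc.eq0_normc/le_anti; rewrite normc_ge0 andbT.
pose L := K x + eta^-1 * eta^-1 *
  (2 * (B * (rho_coef + eta^-1) / (1 - (1 - gap))) * \int[mu]_y (k x y * rho y)).
apply: (le_of_geometric_error onem_gap01 (c := L)) => n; rewrite add0r.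
rewrite -[g x - _](subrKA (u n.+1 x)).
apply: (le_trans (le_normcD _ _)); rewrite /L mulrDl; apply: lerD.
  rewrite normcB_sym; apply: (le_trans (gu n.+1 x)).
  rewrite exprS mulrCA ler_piMl//.
    exact: le_trans (normc_ge0 _) (gu n x).
  by case/andP: onem_gap01 => _ /ltW.
apply: le_trans (normc_qve_map_sub_le x ez ez (ub n) gb) _.
rewrite subrr ComplexField.Normc.normc0 add0r -[leRHS]mulrA.
have i0 : 0 <= \int[mu]_y (k x y * normc (u n y - g y)).
  by apply: Rintegral_ge0 => y _; rewrite mulr_ge0 ?normc_ge0.
apply: ler_pM; rewrite ?mulr_ge0 ?normc_ge0//.
  by rewrite ler_pM ?normc_ge0 ?normc_qve_map_le.
rewrite mulrAC -RintegralZl//; last exact: integrable_kernel_rho.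
apply: le_Rintegral => //.
- apply: (@integrable_kernel_normc _ _ (eta^-1 + eta^-1)).
    by apply: cmeasurableB => //; case: (ub n).
  move=> y; rewrite (le_trans (normc_leB _ _))// lerD//.
    by case: (ub n) => _ /(_ y)[].
  by case: gb => _ /(_ y)[].
- exact: integrableZR (integrable_kernel_rho x).
move=> y _; rewrite mulrCA ler_wpM2l//; apply: (le_trans (gu n y)).
by rewrite le_eqVlt; apply/orP; left; apply/eqP; ring.
Qed.

(** Iterating the contraction in the norm weighted by the barrier turns any a
    priori bound on q into the one dictated by the source term. *)
Lemma barrier_comparison z1 z2 g1 g2 (q : T -> R) F B :
  eta <= Im z1 -> eta <= Im z2 ->
  half_disk_fun eta g1 -> half_disk_fun eta g2 ->
  g1 = qve_map k z1 g1 -> g2 = qve_map k z2 g2 -> measurable_fun setT q ->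
  (forall x, 0 <= q x <= B * barrier g1 g2 x) ->
  (forall x, q x <= F * barrier g1 g2 x +
     normc (g1 x) * normc (g2 x) * \int[mu]_y (k x y * q y)) ->
  forall x, q x <= F / gap * barrier g1 g2 x.
Proof.
move=> e1 e2 b1 b2 s1 s2 mq qB qF x; have e0 := gap_gt0.
(* b |-> F + (1 - gap) b has fixed point F / gap; the bound tends to it. *)
have it n y : 0 <= q y <=
    (F / gap + (1 - gap) ^+ n * (B - F / gap)) * barrier g1 g2 y.
  elim: n y => [|n IH] y; first by rewrite expr0 mul1r subrKC.
  have /andP[-> _] /= := qB y; apply: (le_trans (qF y)).
  have := barrier_step y e1 e2 b1 b2 mq IH; rewrite -s1 -s2 => h.
  apply: (le_trans (lerD (lexx _) h)); rewrite -mulrDl.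
  rewrite ler_wpM2r ?barrier_ge0// exprS le_eqVlt; apply/orP; left; apply/eqP.
  by field; rewrite gt_eqF.
apply: (le_of_geometric_error onem_gap01
  (c := (B - F / gap) * barrier g1 g2 x)) => n.
have /andP[_ h] := it n x; apply: (le_trans h).
by rewrite le_eqVlt; apply/orP; left; apply/eqP; ring.
Qed.

(** A Schwarz-Pick bound: |g1 - g2| and |z1 - z2| / eta times the geometric mean of
    the imaginary parts are a sub- and a supersolution of the same equation, and
    the comparison principle with zero source applies to the positive part of their
    difference. *)
Lemma solution_lipschitz z1 z2 g1 g2 x :
  eta <= Im z1 -> eta <= Im z2 ->
  half_disk_fun eta g1 -> half_disk_fun eta g2 ->
  g1 = qve_map k z1 g1 -> g2 = qve_map k z2 g2 ->
  normc (g1 x - g2 x) <= normc (z1 - z2) * eta^-1 ^+ 2.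
Proof.
move=> e1 e2 b1 b2 s1 s2; have [[m1 _] [m2 _]] := (b1, b2).
pose dl := normc (z1 - z2) / eta.
have dl0 : 0 <= dl by rewrite mulr_ge0 ?normc_ge0.
pose E := geom_mean_Im g1 g2.
have mE : measurable_fun setT E by exact: measurable_geom_mean_Im.
have mD : measurable_fun setT (fun y => normc (g1 y - g2 y)).
  by apply: measurable_normc; exact: cmeasurableB.
pose q y := Num.max 0 (normc (g1 y - g2 y) - dl * E y).
have mq : measurable_fun setT q.
  apply: measurable_maxr; first exact: measurable_cst.
  by apply: measurable_funB => //; exact: measurable_funM.
have q0 y : 0 <= q y by rewrite le_max lexx.
have qD y : q y <= normc (g1 y - g2 y).
  rewrite ge_max normc_ge0 gerBl mulr_ge0//.
  exact: geom_mean_Im_ge0.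
have Dle y : normc (g1 y - g2 y) <= eta^-1 + eta^-1.
  rewrite (le_trans (normc_leB _ _))// lerD//.
    by case: b1 => _ /(_ y)[].
  by case: b2 => _ /(_ y)[].
have qx y : q y <= 0 / gap * barrier g1 g2 y.
  apply: (@barrier_comparison z1 z2 g1 g2 q 0 (2 * eta^-1 / rho_coef)) => //.
    by move=> t; rewrite q0 (le_trans (qD t))// normc_sub_barrier.
  move=> t; rewrite mul0r add0r.
  have iD : integrable (fun y => k t y * normc (g1 y - g2 y)).
    apply: (@integrable_kernel_bounded _ _ (eta^-1 + eta^-1)) => // u.
    by rewrite ger0_norm ?normc_ge0.
  have iE : integrable (fun y => k t y * E y).
    apply: (@integrable_kernel_bounded _ _ (eta^-1)) => // u.
    by rewrite ger0_norm ?geom_mean_Im_ge0// geom_mean_Im_le.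
  have iq : integrable (fun y => k t y * q y).
    apply: (@integrable_kernel_bounded _ _ (eta^-1 + eta^-1)) => // u.
    by rewrite ger0_norm// (le_trans (qD u)).
  have m0 : 0 <= normc (g1 t) * normc (g2 t) by rewrite mulr_ge0 ?normc_ge0.
  rewrite {1}/q ge_max mulr_ge0//=; last first.
    by apply: Rintegral_ge0 => y' _; rewrite mulr_ge0.
  have h1 := normc_qve_map_sub_le t e1 e2 b1 b2.
  have h2 := geom_mean_Im_supersolution t e1 e2 b1 b2.
  rewrite -s1 -s2 -/E in h1 h2.
  have h3 : \int[mu]_y (k t y * normc (g1 y - g2 y)) - dl * \int[mu]_y (k t y * E y)
      <= \int[mu]_y (k t y * q y).
    rewrite -RintegralZl// -RintegralB//; last exact: integrableZR.
    apply: le_Rintegral => //.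
      have := integrableB measurableT iD (integrableZR dl iE).
      by under eq_fun do rewrite /= -EFinB.
    by move=> u _; rewrite mulrCA -mulrBr ler_wpM2l// le_max lexx orbT.
  have h4 : dl * (normc (g1 t) * normc (g2 t) *
      (eta + \int[mu]_y (k t y * E y))) <= dl * E t by rewrite ler_wpM2l.
  have h5 := ler_wpM2l m0 h3.
  have h6 : dl * eta = normc (z1 - z2) by rewrite divfK ?gt_eqF.
  rewrite lerBlDr; apply: (le_trans h1); rewrite -h6.
  set I1 := Rintegral _ _ _ in h3 h5 *; set I2 := Rintegral _ _ _ in h3 h4 h5 *.
  set I3 := Rintegral _ _ _ in h5 *; set m := _ * normc (g2 t) in h4 h5 *.
  apply: le_trans (lerD h5 h4).
  by rewrite le_eqVlt; apply/orP; left; apply/eqP; ring.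
have := qx x; rewrite mul0r mul0r ge_max lexx /= subr_le0 => /le_trans; apply.
rewrite /dl -mulrA ler_wpM2l ?normc_ge0// expr2 ler_wpM2l//.
exact: geom_mean_Im_le.
Qed.

Lemma solution_unique z g1 g2 : eta <= Im z ->
  half_disk_fun eta g1 -> half_disk_fun eta g2 ->
  g1 = qve_map k z g1 -> g2 = qve_map k z g2 -> g1 = g2.
Proof.
move=> ez b1 b2 s1 s2; apply/funext => x; apply/eqP; rewrite -subr_eq0.
apply/eqP/ComplexField.Normc.eq0_normc/le_anti; rewrite normc_ge0 andbT.
have := solution_lipschitz x ez ez b1 b2 s1 s2.
by rewrite subrr ComplexField.Normc.normc0 mul0r.
Qed.

(** * Difference quotients in the spectral parameter *)

Section DifferenceQuotient.
Variables (z h : R[i]) (g0 g1 : T -> R[i]).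
Hypotheses (ez : eta <= Im z) (ezh : eta <= Im (z + h)) (h_neq0 : h != 0).
Hypotheses (b0 : half_disk_fun eta g0) (b1 : half_disk_fun eta g1).
Hypotheses (s0 : g0 = qve_map k z g0) (s1 : g1 = qve_map k (z + h) g1).

Let quot x := h^-1 * (g1 x - g0 x).

Lemma cmeasurable_quotient : cmeasurable quot.
Proof.
by apply: cmeasurableZ; apply: cmeasurableB; [case: b1|case: b0].
Qed.

Lemma normc_quotient_le x : normc (quot x) <= eta^-1 ^+ 2.
Proof.
rewrite ComplexField.Normc.normcM ComplexField.Normc.normcV.
have nh : 0 < normc h.
  rewrite lt_neqAle normc_ge0 andbT eq_sym; apply: contra h_neq0 => /eqP.
  by move/ComplexField.Normc.eq0_normc => ->.
rewrite mulrC ler_pdivrMr// mulrC.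
have := solution_lipschitz x ezh ez b1 b0 s1 s0.
by rewrite addrAC subrr add0r.
Qed.

Lemma quotient_equation x : quot x = g1 x * g0 x * (1 + kernel_op k quot x).
Proof.
have [[m0 n0] [m1 n1]] := (b0, b1).
have i0 : integrable (fun y => k x y * normc (g0 y)).
  by apply: (@integrable_kernel_normc _ _ (eta^-1)) => // y; case: (n0 y).
have i1 : integrable (fun y => k x y * normc (g1 y)).
  by apply: (@integrable_kernel_normc _ _ (eta^-1)) => // y; case: (n1 y).
have E : g1 x - g0 x = g1 x * g0 x * (h + (kernel_op k g1 x - kernel_op k g0 x)).
  rewrite {1}s1 {1}s0 /qve_map Ninv_sub; [|exact: argument_neq0..].
  have P1 : - (1 / (z + h + kernel_op k g1 x)) = g1 x by rewrite [in RHS]s1.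
  have P0 : - (1 / (z + kernel_op k g0 x)) = g0 x by rewrite [in RHS]s0.
  rewrite P1 P0; congr (_ * _); ring.
rewrite /quot E mulrCA; congr (_ * _).
rewrite mulrDr mulVf//; congr (_ + _).
rewrite /kernel_op wcintegralZ//; first by rewrite wcintegralB.
  exact: cmeasurableB.
apply: (@integrable_kernel_normc _ _ (eta^-1 + eta^-1)); first exact: cmeasurableB.
move=> y; rewrite (le_trans (normc_leB _ _))// lerD//.
  by case: (n1 y).
by case: (n0 y).
Qed.

Lemma normc_kernel_op_quotient_le x :
  1 + normc (kernel_op k quot x) <= (2 + eta^-1 ^+ 2 * C) * rho x.
Proof.
have iq := integrable_kernel_normc x cmeasurable_quotient normc_quotient_le.
have ir := integrableZR (eta^-1 ^+ 2) (integrable_kernel_rho x).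
have h1 := normc_wcintegral_le (mkx x) (k_ge0 x) cmeasurable_quotient iq.
have h2 : \int[mu]_y (k x y * normc (quot y)) <=
    eta^-1 ^+ 2 * \int[mu]_y (k x y * rho y).
  rewrite -RintegralZl//; last exact: integrable_kernel_rho.
  apply: le_Rintegral => // y _; rewrite mulrCA ler_wpM2l//.
  by apply: (le_trans (normc_quotient_le y)); rewrite ler_peMr// exprn_ge0.
have h3 : eta^-1 ^+ 2 * \int[mu]_y (k x y * rho y) <=
    eta^-1 ^+ 2 * (eta ^+ 2 / 2 * rho x + C).
  by rewrite ler_wpM2l ?exprn_ge0// kernel_rho_le.
have h4 : eta^-1 ^+ 2 * (eta ^+ 2 / 2 * rho x + C) =
    rho x / 2 + eta^-1 ^+ 2 * C by field; rewrite gt_eqF.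
have h5 : eta^-1 ^+ 2 * C <= eta^-1 ^+ 2 * C * rho x.
  by rewrite ler_peMr// mulr_ge0// exprn_ge0.
have := rho_ge1 x; rewrite /kernel_op mulrDl; lra.
Qed.

End DifferenceQuotient.

Definition quotient_modulus : R :=
  eta^-1 ^+ 3 * (2 + eta^-1 ^+ 2 * C) / rho_coef / gap * (rho_coef + eta^-1).

(** The quotients d_i = (g_i - g0) / h_i satisfy
    d1 - d2 = (g1 - g2) g0 (1 + S d1) + g2 g0 S (d1 - d2), an equation to which
    the comparison principle applies, with a source of size |h1 - h2| rho. *)
Lemma quotient_sub_le z h1 h2 g0 g1 g2 x :
  eta <= Im z -> eta <= Im (z + h1) -> eta <= Im (z + h2) ->
  h1 != 0 -> h2 != 0 ->
  half_disk_fun eta g0 -> half_disk_fun eta g1 ->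
  half_disk_fun eta g2 ->
  g0 = qve_map k z g0 -> g1 = qve_map k (z + h1) g1 -> g2 = qve_map k (z + h2) g2 ->
  normc (h1^-1 * (g1 x - g0 x) - h2^-1 * (g2 x - g0 x)) <=
  normc (h1 - h2) * quotient_modulus * rho x.
Proof.
move=> ez e1 e2 h10 h20 b0 b1 b2 s0 s1 s2.
pose d1 y := h1^-1 * (g1 y - g0 y); pose d2 y := h2^-1 * (g2 y - g0 y).
have md1 : cmeasurable d1 by exact: cmeasurable_quotient b0 b1.
have md2 : cmeasurable d2 by exact: cmeasurable_quotient b0 b2.
have d1e y : normc (d1 y) <= eta^-1 ^+ 2.
  exact: (normc_quotient_le ez e1 h10 b0 b1 s0 s1).
have d2e y : normc (d2 y) <= eta^-1 ^+ 2.
  exact: (normc_quotient_le ez e2 h20 b0 b2 s0 s2).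
have i1 y := integrable_kernel_normc y md1 d1e.
have i2 y := integrable_kernel_normc y md2 d2e.
have md : cmeasurable (fun y => d1 y - d2 y) by exact: cmeasurableB.
have de y : normc (d1 y - d2 y) <= eta^-1 ^+ 2 + eta^-1 ^+ 2.
  by rewrite (le_trans (normc_leB _ _))// lerD.
have id y := integrable_kernel_normc y md de.
have a0 := rho_coef_gt0; have e0 := gap_gt0.
pose M := 2 + eta^-1 ^+ 2 * C.
have M0 : 0 <= M by rewrite addr_ge0// mulr_ge0// exprn_ge0.
pose F := normc (h1 - h2) * (eta^-1 ^+ 3 * M / rho_coef).
have F0 : 0 <= F.
  by rewrite mulr_ge0 ?normc_ge0// divr_ge0 ?(ltW a0)// mulr_ge0// exprn_ge0.
have B0 : 0 <= 2 * eta^-1 ^+ 2 / rho_coef.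
  by apply: divr_ge0; [rewrite mulr_ge0 ?exprn_ge0|exact: ltW].
apply: (@le_trans _ _ (F / gap * barrier g2 g0 x)); last first.
  have -> : normc (h1 - h2) * quotient_modulus * rho x =
      F / gap * ((rho_coef + eta^-1) * rho x).
    by rewrite /F /quotient_modulus -/M; ring.
  by rewrite ler_wpM2l ?barrier_le// divr_ge0// ltW.
apply: (@barrier_comparison (z + h2) z g2 g0 (fun y => normc (d1 y - d2 y)) F
  (2 * eta^-1 ^+ 2 / rho_coef)) => //.
- exact: measurable_normc.
- move=> y; rewrite normc_ge0 /=; apply: (le_trans (de y)).
  apply: (@le_trans _ _ (2 * eta^-1 ^+ 2 / rho_coef * rho_coef)).
    by rewrite divfK ?gt_eqF// mulr_natl mulr2n.
  exact: ler_wpM2l (barrier_ge _ _ _).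
move=> y.
have -> : d1 y - d2 y = (g1 y - g2 y) * (g0 y * (1 + kernel_op k d1 y)) +
    g2 y * g0 y * kernel_op k (fun t => d1 t - d2 t) y.
  rewrite /kernel_op wcintegralB// -/(kernel_op k d1 y) -/(kernel_op k d2 y).
  have E1 := quotient_equation ez e1 h10 b0 b1 s0 s1 y.
  have E2 := quotient_equation ez e2 h20 b0 b2 s0 s2 y.
  rewrite -/(d1 y) -/d1 in E1; rewrite -/(d2 y) -/d2 in E2.
  rewrite [in LHS]E1 [in LHS]E2; ring.
apply: (le_trans (le_normcD _ _)); apply: lerD; last first.
  rewrite !ComplexField.Normc.normcM ler_wpM2l ?mulr_ge0 ?normc_ge0//.
  exact: normc_wcintegral_le.
rewrite !ComplexField.Normc.normcM.
have L := solution_lipschitz y e1 e2 b1 b2 s1 s2.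
rewrite (_ : z + h1 - (z + h2) = h1 - h2) in L; last by ring.
have N0 : normc (g0 y) <= eta^-1 by case: b0 => _ /(_ y)[].
have S1 : normc (1 + kernel_op k d1 y) <= M * rho y.
  apply: (le_trans (le_normcD _ _)); rewrite ComplexField.Normc.normc1.
  exact: (normc_kernel_op_quotient_le ez e1 h10 b0 b1 s0 s1).
apply: (@le_trans _ _ (normc (h1 - h2) * eta^-1 ^+ 2 * (eta^-1 * (M * rho y)))).
  apply: ler_pM => //; rewrite ?mulr_ge0 ?normc_ge0//.
  by apply: ler_pM; rewrite ?normc_ge0.
apply: (@le_trans _ _ (F * (rho_coef * rho y))).
  rewrite /F le_eqVlt; apply/orP; left; apply/eqP.
  by field; rewrite ?gt_eqF.
by rewrite ler_wpM2l// lerDl geom_mean_Im_ge0.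
Qed.

(** The derivative is the pointwise limit of the quotients along the real
    increments 2^-n, which stay in the half plane; the bound on the difference of two
    quotients then compares it with the quotient at an arbitrary increment. *)
Lemma solution_derivative z (g : R[i] -> T -> R[i]) : eta <= Im z ->
  (forall z', eta <= Im z' ->
     half_disk_fun eta (g z') /\ g z' = qve_map k z' (g z')) ->
  exists2 d : T -> R[i], cmeasurable d /\ (forall x, normc (d x) <= eta^-1 ^+ 2) &
    exists2 K, 0 <= K & forall h x, h != 0 -> eta <= Im (z + h) ->
      normc (h^-1 * (g (z + h) x - g z x) - d x) <= normc h * K * rho x.
Proof.
move=> ez gs; pose D h x := h^-1 * (g (z + h) x - g z x).
have [b0 s0] := gs z ez.
have l01 : 0 <= (1 / 2 : R) < 1 by lra.
pose t n : R := (1 / 2) ^+ n.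
have t0 n : 0 < t n by rewrite exprn_gt0.
have tC0 n : (t n)%:C != 0 :> R[i].
  by apply: contraTneq (t0 n) => -[->]; rewrite ltxx.
have et n : eta <= Im (z + (t n)%:C) by rewrite ImD /= addr0.
have tS n : `|t n.+1 - t n| <= t n.
  rewrite /t exprS (_ : _ - _ = - (1 / 2 * t n)); last by rewrite /t; field.
  by rewrite normrN ger0_norm; have := t0 n; rewrite /t; lra.
have Q0 : 0 <= quotient_modulus.
  have a0 := rho_coef_gt0; have e0 := gap_gt0.
  rewrite /quotient_modulus mulr_ge0 ?addr_ge0 ?(ltW a0)//.
  rewrite divr_ge0 ?(ltW e0)// divr_ge0 ?(ltW a0)// mulr_ge0 ?exprn_ge0//.
  by rewrite addr_ge0// mulr_ge0// exprn_ge0.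
have incr n x : normc (D (t n.+1)%:C x - D (t n)%:C x) <=
    quotient_modulus * rho x * (1 / 2) ^+ n.
  have [b1 s1] := gs _ (et n.+1); have [b2 s2] := gs _ (et n).
  apply: (le_trans (quotient_sub_le x ez _ _ _ _ b0 b1 b2 s0 s1 s2)) => //.
  rewrite -mulrA mulrC; apply: ler_wpM2l; first exact: (mulr_ge0 Q0 (rho_ge0 x)).
  by rewrite (_ : _ - _ = (t n.+1 - t n)%:C) ?normc_real ?tS// rmorphB.
have mD n : cmeasurable (D (t n)%:C).
  have [b1 s1] := gs _ (et n); exact: cmeasurable_quotient b0 b1.
have [d' md dD] := geometric_limit_fun l01 mD incr.
exists d'.
  split => // x; apply: (le_of_geometric_error l01) => n.
  have [b1 s1] := gs _ (et n).
  rewrite -[d' x](subKr (D (t n)%:C x)).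
  apply: (le_trans (normc_leB _ _)); apply: lerD (dD n x).
  exact: (normc_quotient_le ez (et n) (tC0 n) b0 b1 s0 s1).
exists quotient_modulus => // h x h0 eh.
apply: (@le_of_geometric_error _ _ _ (quotient_modulus * rho x +
  2 * (quotient_modulus * rho x / (1 - 1 / 2))) _ l01) => n.
have [b1 s1] := gs _ eh; have [b2 s2] := gs _ (et n).
rewrite -[_ - d' x](subrKA (D (t n)%:C x)).
apply: (le_trans (le_normcD _ _)); rewrite mulrDl addrA; apply: lerD (dD n x).
apply: (le_trans (quotient_sub_le x ez eh (et n) h0 (tC0 n) b0 b1 b2 s0 s1 s2)).
have : normc (h - (t n)%:C) <= normc h + t n.
  by apply: (le_trans (normc_leB _ _)); rewrite normc_real gtr0_norm.
move=> /(ler_wpM2r (mulr_ge0 Q0 (rho_ge0 x))).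
by rewrite mulrDl (mulrC (t n)) !mulrA.
Qed.

End FixedKernel.
End Kernel.

(** * Sublinear weights of square integrable kernels *)

Section HilbertSchmidt.
Context d (T : measurableType d) (R : realType).
Variable mu : {finite_measure set T -> \bar R}.
Local Notation integrable f := (mu.-integrable setT (EFin \o f)).

Section SquareIntegrableKernel.
Variable k : T -> T -> R.
Hypothesis mk : measurable_fun setT (fun p : T * T => k p.1 p.2).
Hypothesis k_ge0 : forall x y, 0 <= k x y.
Hypothesis k_row : forall x, (\int[mu]_y (k x y ^+ 2)%:E < +oo)%E.
Hypothesis k_sqr : (\int[mu]_x \int[mu]_y (k x y ^+ 2)%:E < +oo)%E.

Let excess (N : nat) (p : T * T) : R := Num.max 0 (k p.1 p.2 - N%:R).

Let excess_ge0 N p : 0 <= excess N p.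
Proof. by rewrite le_max lexx. Qed.

Let excess_le N p : excess N p <= k p.1 p.2.
Proof. by rewrite ge_max k_ge0 gerBl ler0n. Qed.

Let k_le_excess N p : k p.1 p.2 <= N%:R + excess N p.
Proof. by rewrite -lerBlDl le_max lexx orbT. Qed.

Let measurable_excess N : measurable_fun setT (excess N).
Proof.
apply: measurable_maxr => //.
exact: measurable_funB.
Qed.

Let sqr_excess_le N p : excess N p ^+ 2 <= k p.1 p.2 ^+ 2.
Proof. by rewrite ler_pXn2r ?nnegrE. Qed.

(** Dominated convergence on the product space: the part of k above level N tends
    to 0 in the Hilbert-Schmidt norm. *)
Lemma cvg_sqr_excess :
  (\int[mu]_x \int[mu]_y (excess N (x, y) ^+ 2)%:E)%E @[N --> \oo] --> 0%E.
Proof.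
pose f N (p : T * T) := (excess N p ^+ 2)%:E.
have mf N : measurable_fun setT (f N).
  by apply/measurable_EFinP; exact: measurable_funX.
have mk2 : measurable_fun setT (fun p : T * T => (k p.1 p.2 ^+ 2)%:E).
  by apply/measurable_EFinP; exact: measurable_funX.
have ik2 : (mu \x mu)%E.-integrable setT (fun p : T * T => (k p.1 p.2 ^+ 2)%:E).
  apply/(integrable12ltyP _ _ mk2); apply: le_lt_trans k_sqr.
  rewrite le_eqVlt; apply/orP; left; apply/eqP.
  apply: eq_integral => x _; apply: eq_integral => y _ /=.
  by rewrite ger0_norm// sqr_ge0.
have cv : {ae (mu \x mu)%E, forall p, setT p -> f ^~ p @ \oo --> cst 0%E p}.
  apply/nearW => p _; apply: cvg_near_cst.
  exists (Num.bound (k p.1 p.2)) => // n /= Nn; rewrite /f /excess.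
  rewrite (_ : Num.max _ _ = 0) ?expr0n//; apply/max_idPl.
  rewrite subr_le0 ltW// (lt_le_trans (archi_boundP (k_ge0 _ _)))//.
  by rewrite ler_nat.
have dom : {ae (mu \x mu)%E, forall p n, setT p ->
    (`|f n p| <= (k p.1 p.2 ^+ 2)%:E)%E}.
  apply/nearW => p n _; rewrite /f /= ger0_norm ?sqr_ge0//.
  by rewrite lee_fin.
have [_ _] := dominated_convergence measurableT mf (measurable_cst _) cv ik2 dom.
rewrite integral0 => h.
have -> : (fun N => \int[mu]_x \int[mu]_y (excess N (x, y) ^+ 2)%:E)%E =
    (fun N => \int[(mu \x mu)%E]_p f N p)%E.
  apply/funext => N; rewrite fubini_tonelli1//.
  by move=> p; rewrite lee_fin sqr_ge0.
exact: h.
Qed.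

Lemma integrable_sqr_excess_row N x : integrable (fun y => excess N (x, y) ^+ 2).
Proof.
have mr : measurable_fun setT (fun y => excess N (x, y)).
  exact: (measurable_fun_pair2 x (@measurable_excess N)).
apply/integrableP; split.
  by apply/measurable_EFinP; exact: measurable_funX.
apply: le_lt_trans (k_row x); apply: ge0_le_integral => //.
- by apply: measurableT_comp => //; apply/measurable_EFinP; exact: measurable_funX.
- apply/measurable_EFinP; apply: measurable_funX.
  exact: (measurable_fun_pair2 x mk).
by move=> y _; rewrite /= lee_fin ger0_norm ?sqr_ge0// sqr_excess_le.
Qed.

(** With s2 x the squared norm of the row x of the excess of k above N, the weight
    is rho = sqrt (1 + s2 / th^2). Young's inequality with parameter
    1 / (th rho x) bounds the contribution of the large values of k by a small
    multiple of rho x, while the values below N contribute a constant. *)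
Lemma sublinear_weight_exists (kappa : R) : 0 < kappa ->
  exists rho C, sublinear_weight mu k kappa rho C.
Proof.
move=> kappa0; pose A := fine (mu setT) + 1.
have A1 : 1 <= A by rewrite lerDr fine_ge0.
have A0 : 0 < A by exact: lt_le_trans A1.
(* A bounds the integral of rho ^ 2, and the truncation error contributes
   th (1 + A) rho x / 2. *)
pose th := kappa / (1 + A).
have A1p : 0 < 1 + A by rewrite addr_gt0.
have th0 : 0 < th by rewrite divr_gt0.
have [N HN] : exists N,
    (\int[mu]_x \int[mu]_y (excess N (x, y) ^+ 2)%:E < (th ^+ 2)%:E)%E.
  have th2 : (0 < (th ^+ 2)%:E)%E by rewrite lte_fin exprn_gt0.
  have [N _ HN] := cvg_sqr_excess (open_nbhs_nbhs
    (conj (@open_ereal_lt_ereal R (th ^+ 2)%:E) th2)).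
  by exists N; exact: (HN N (leqnn N)).
pose s2 x : R := \int[mu]_y (excess N (x, y) ^+ 2).
have s2E x : (s2 x)%:E = (\int[mu]_y (excess N (x, y) ^+ 2)%:E)%E.
  rewrite /s2 /Rintegral fineK//.
  by have := integrable_fin_num measurableT (integrable_sqr_excess_row N x).
have s20 x : 0 <= s2 x by apply: Rintegral_ge0 => y _; rewrite sqr_ge0.
have ms2 : measurable_fun setT s2.
  rewrite /s2 /Rintegral; apply: (measurableT_comp (fine_measurable measurableT)).
  apply: (@measurable_fun_fubini_tonelli_F _ _ _ _ _ mu
    (fun p => (excess N p ^+ 2)%:E)).
    by apply/measurable_EFinP; exact: measurable_funX.
  by move=> p; rewrite lee_fin sqr_ge0.
have is2 : integrable s2.
  apply/integrableP; split; first exact/measurable_EFinP.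
  apply: (@lt_trans _ _ (th ^+ 2)%:E); last exact: ltry.
  apply: le_lt_trans HN; rewrite le_eqVlt; apply/orP; left; apply/eqP.
  by apply: eq_integral => x _; rewrite -s2E /= ger0_norm.
have s2le : \int[mu]_x s2 x <= th ^+ 2.
  rewrite -lee_fin /Rintegral fineK; last exact: integrable_fin_num is2.
  apply: le_trans (ltW HN); rewrite le_eqVlt; apply/orP; left; apply/eqP.
  by apply: eq_integral => x _; rewrite -s2E.
pose rho x : R := Num.sqrt (1 + s2 x / th ^+ 2).
have rho2 x : rho x ^+ 2 = 1 + s2 x / th ^+ 2.
  by rewrite sqr_sqrtr// addr_ge0// divr_ge0// sqr_ge0.
have rho1 x : 1 <= rho x.
  by rewrite -[leLHS]sqrtr1 ler_wsqrtr// lerDl divr_ge0// sqr_ge0.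
have rho0 x : 0 < rho x by exact: lt_le_trans (rho1 x).
have mrho : measurable_fun setT rho.
  apply: measurable_sqrt; apply: measurable_funD => //.
  exact: measurable_funM.
have i1 : integrable (fun _ : T => 1 : R) by exact: finite_measure_integrable_cst.
have irho2 : integrable (fun x => rho x ^+ 2).
  under eq_fun do rewrite rho2 mulrC.
  exact: integrableDR i1 (integrableZR _ is2).
have rho2A : \int[mu]_x (rho x ^+ 2) <= A.
  under eq_Rintegral do rewrite rho2 mulrC.
  rewrite RintegralD//; last exact: integrableZR.
  rewrite RintegralZl// Rintegral_cst// mul1r /A lerD2l mulrC.
  by rewrite ler_pdivrMr ?exprn_gt0// mul1r.
exists rho, (N%:R * A); split => //; first by rewrite mulr_ge0 ?ler0n ?(ltW A0).
move=> x; pose c1 := N%:R + th * rho x / 2; pose c2 := (2 * (th * rho x))^-1.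
have tr0 : 0 < th * rho x by rewrite mulr_gt0.
have ie := integrable_sqr_excess_row N x.
have iR : integrable (fun y => c1 * rho y ^+ 2 + c2 * excess N (x, y) ^+ 2).
  by apply: integrableDR; exact: integrableZR.
have young y : k x y * rho y <= c1 * rho y ^+ 2 + c2 * excess N (x, y) ^+ 2.
  apply: (@le_trans _ _ ((N%:R + excess N (x, y)) * rho y)).
    by rewrite ler_wpM2r ?(ltW (rho0 y))// (k_le_excess N (x, y)).
  have h1 : N%:R * rho y <= N%:R * rho y ^+ 2.
    by rewrite ler_wpM2l ?ler0n// expr2 ler_peMr// ltW.
  have h2 : excess N (x, y) * rho y <=
      th * rho x / 2 * rho y ^+ 2 + c2 * excess N (x, y) ^+ 2.
    rewrite -subr_ge0 (_ : _ - _ =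
      c2 * (th * rho x * rho y - excess N (x, y)) ^+ 2).
      by rewrite mulr_ge0 ?sqr_ge0// invr_ge0 mulr_ge0// ltW.
    by rewrite /c2; field; rewrite !gt_eqF.
  by rewrite /c1 !mulrDl -addrA; exact: lerD.
apply: (@le_trans _ _
    (\int[mu]_y (c1 * rho y ^+ 2 + c2 * excess N (x, y) ^+ 2)%:E)%E).
  apply: ge0_le_integral => //.
  - by move=> y _; rewrite lee_fin mulr_ge0// ltW.
  - apply/measurable_EFinP; apply: measurable_funM => //.
    exact: (measurable_fun_pair2 x mk).
  - exact: (measurable_int _ iR).
  by move=> y _; rewrite lee_fin.
rewrite -[leLHS](fineK (integrable_fin_num measurableT iR)) lee_fin.
rewrite -/(Rintegral _ _ _) RintegralD//; [|exact: integrableZR..].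
rewrite !RintegralZl// -/(s2 x).
have c10 : 0 <= c1 by rewrite addr_ge0 ?ler0n// divr_ge0// ltW.
apply: (le_trans (lerD (ler_wpM2l c10 rho2A) (lexx _))).
have s2r : s2 x <= th ^+ 2 * rho x ^+ 2.
  rewrite rho2 mulrDr mulr1 mulrCA divff ?mulr1 ?gt_eqF ?exprn_gt0//.
  by rewrite lerDr sqr_ge0.
have c20 : 0 <= c2 by rewrite invr_ge0 mulr_ge0// ltW.
apply: (le_trans (lerD (lexx _) (ler_wpM2l c20 s2r))).
have -> : c1 * A + c2 * (th ^+ 2 * rho x ^+ 2) =
    th * (1 + A) * rho x / 2 + N%:R * A.
  by rewrite /c1 /c2; field; rewrite !gt_eqF.
rewrite lerD2r /th divfK ?gt_eqF// ler_piMr ?mulr_ge0 ?(ltW kappa0) ?(ltW (rho0 x))//.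
by rewrite invf_le1// ler1n.
Qed.

End SquareIntegrableKernel.
End HilbertSchmidt.

(** * Modification of the kernel on a null set *)

Section Regularisation.
Context d (T : measurableType d) (R : realType).
Variable mu : {finite_measure set T -> \bar R}.

(** By Tonelli, the iterated integral of the negative part of s vanishes. *)
Lemma ae_sections_ge0 (s : T * T -> R) : measurable_fun setT s ->
  {ae (mu \x mu)%E, forall p, 0 <= s p} ->
  {ae mu, forall x, {ae mu, forall y, 0 <= s (x, y)}}.
Proof.
move=> ms s0; pose n (p : T * T) := (Num.max 0 (- s p))%:E.
have mn : measurable_fun setT n.
  by apply/measurable_EFinP; apply: measurable_maxr => //; exact: measurable_funN.
have n0 p : (0 <= n p)%E by rewrite lee_fin le_max lexx.
have : (\int[(mu \x mu)%E]_p `|n p|)%E = 0%E.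
  apply/(ae_eq_integral_abs _ measurableT mn).
  apply: filterS s0 => p sp _; rewrite /n /= (_ : Num.max _ _ = 0)//.
  by apply/max_idPl; rewrite oppr_le0.
under eq_integral do rewrite gee0_abs//.
rewrite fubini_tonelli1// => h.
have mF : measurable_fun setT (fun x => \int[mu]_y n (x, y))%E.
  exact: (@measurable_fun_fubini_tonelli_F _ _ _ _ _ mu n).
have : (\int[mu]_x `|\int[mu]_y n (x, y)|)%E = 0%E.
  rewrite -[RHS]h; apply: eq_integral => x _; rewrite gee0_abs//.
  exact: integral_ge0.
move=> /(ae_eq_integral_abs _ measurableT mF); apply: filterS => x /(_ Logic.I) /= hx.
have mr : measurable_fun setT (fun y => n (x, y)) by exact: (measurable_fun_pair2 x mn).
have : (\int[mu]_y `|n (x, y)|)%E = 0%E.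
  by rewrite -[RHS]hx; apply: eq_integral => y _; rewrite gee0_abs.
move=> /(ae_eq_integral_abs _ measurableT mr); apply: filterS => y /(_ Logic.I) /=.
by move=> [] /max_idPl; rewrite oppr_le0.
Qed.

(** Replacing s by its positive part, and by 0 on the null set of rows that are
    not square integrable, makes all the properties of the kernel hold everywhere. *)
Lemma tame_modification (s : T * T -> R) : s \in Lfun (mu \x mu)%E 2%:E ->
  {ae (mu \x mu)%E, forall p, 0 <= s p} ->
  measurable_fun setT s /\ exists2 k, tame_kernel mu k &
    {ae mu, forall x, {ae mu, forall y, k x y = s (x, y)}}.
Proof.
move=> sL s0; have ms : measurable_fun setT s.
  by move/sub_Lfun_mfun : sL; rewrite inE.
split => //; have is2 := Lfun2_integrable_sqr sL.
pose sp (p : T * T) := Num.max 0 (s p).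
have msp : measurable_fun setT sp by exact: measurable_maxr.
have sp0 p : 0 <= sp p by rewrite le_max lexx.
have sp2 p : sp p ^+ 2 <= s p ^+ 2.
  rewrite /sp; case: (leP 0 (s p)) => // _; by rewrite expr0n /= sqr_ge0.
have msp2 : measurable_fun setT (fun p => (sp p ^+ 2)%:E).
  by apply/measurable_EFinP; exact: measurable_funX.
have isp2 : (mu \x mu)%E.-integrable setT (fun p => (sp p ^+ 2)%:E).
  apply: le_integrable is2 => // p _.
  by rewrite /= lee_fin !ger0_norm ?sqr_ge0.
pose row x := (\int[mu]_y (sp (x, y) ^+ 2)%:E)%E.
have row0 x : (0 <= row x)%E by apply: integral_ge0 => y _; rewrite lee_fin sqr_ge0.
have mrow : measurable_fun setT row.
  apply: (@measurable_fun_fubini_tonelli_F _ _ _ _ _ mu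
    (fun p => (sp p ^+ 2)%:E)) => //.
  by move=> p; rewrite lee_fin sqr_ge0.
have irow : mu.-integrable setT row.
  have := integrable_fubini_F isp2; exact.
pose X0 := [set x | (row x < +oo)%E].
have mX0 : measurable X0.
  have := emeasurable_fun_infty_o measurableT mrow +oo%E.
  by rewrite setTI.
pose k x y : R := \1_X0 x * sp (x, y).
have k0 x y : 0 <= k x y by rewrite mulr_ge0// indicE.
have mk : measurable_fun setT (fun p : T * T => k p.1 p.2).
  apply: measurable_funM; last first.
    by rewrite (_ : (fun _ => _) = sp)//; apply/funext => -[].
  exact: (measurableT_comp (measurable_indic mX0) measurable_fst).
have k_le x y : k x y ^+ 2 <= sp (x, y) ^+ 2.
  rewrite ler_pXn2r ?nnegrE// /k indicE.
  by case: (x \in X0); rewrite ?mul1r ?mul0r.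
have mk2 x : measurable_fun setT (fun y => (k x y ^+ 2)%:E).
  apply/measurable_EFinP; apply: measurable_funX.
  exact: (measurable_fun_pair2 x mk).
have le_row x : (\int[mu]_y (k x y ^+ 2)%:E <= row x)%E.
  apply: ge0_le_integral => //.
  - by move=> y _; rewrite lee_fin sqr_ge0.
  - exact: (measurable_fun_pair2 x msp2).
  by move=> y _; rewrite lee_fin.
have k_row x : (\int[mu]_y (k x y ^+ 2)%:E < +oo)%E.
  have [xX|xX] := boolP (x \in X0).
    by apply: le_lt_trans (le_row x) _; move: xX; rewrite inE.
  rewrite (_ : (fun _ => _) = fun _ => 0%E) ?integral0//.
  by apply/funext => y; rewrite /k indicE (negbTE xX) mul0r expr0n.
have k_sqr : (\int[mu]_x \int[mu]_y (k x y ^+ 2)%:E < +oo)%E.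
  apply: le_lt_trans (integrable_lty measurableT irow).
  apply: ge0_le_integral => //.
  - by move=> x _; apply: integral_ge0 => y _; rewrite lee_fin sqr_ge0.
  - apply: (@measurable_fun_fubini_tonelli_F _ _ _ _ _ mu
      (fun p => (k p.1 p.2 ^+ 2)%:E)).
      by apply/measurable_EFinP; exact: measurable_funX.
    by move=> p; rewrite lee_fin sqr_ge0.
exists k.
  by split => // kappa; exact: sublinear_weight_exists.
have aeX : {ae mu, forall x, x \in X0}.
  have := integrable_ae measurableT irow; apply: filterS => x /(_ Logic.I) h.
  by rewrite inE /X0 /= -ge0_fin_numE.
have := ae_sections_ge0 ms s0; apply: filterS2 aeX => x xX0.
apply: filterS => y sxy; rewrite /k indicE xX0 mul1r /sp.
exact/max_idPr.
Qed.

Local Notation Re := (@complex.Re R).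
Local Notation Im := (@complex.Im R).

Lemma ae_eq_cintegral (f g : T -> R[i]) : cmeasurable f -> cmeasurable g ->
  {ae mu, forall y, f y = g y} -> cintegral mu f = cintegral mu g.
Proof.
move=> [mfr mfi] [mgr mgi] fg; rewrite /cintegral /Rintegral; congr (fine _ +i* fine _).
  apply: ae_eq_integral => //; [exact/measurable_EFinP..|].
  by apply: filterS fg => y ->.
apply: ae_eq_integral => //; [exact/measurable_EFinP..|].
by apply: filterS fg => y ->.
Qed.

Lemma cmeasurable_scale (w : T -> R) (g : T -> R[i]) : measurable_fun setT w ->
  cmeasurable g -> cmeasurable (fun y => (w y)%:C * g y).
Proof.
move=> mw [mr mi]; split.
  rewrite (_ : _ \o _ = fun y => w y * (Re \o g) y); first exact: measurable_funM.
  by apply/funext => y /=; case: (g y) => a b /=; rewrite mul0r subr0.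
rewrite (_ : _ \o _ = fun y => w y * (Im \o g) y); first exact: measurable_funM.
by apply/funext => y /=; case: (g y) => a b /=; rewrite mul0r addr0.
Qed.

End Regularisation.

(** * From pointwise solutions to square integrable ones *)

Section SquareIntegrable.
Context d (T : measurableType d) (R : realType).
Variable mu : {finite_measure set T -> \bar R}.
Local Notation normc := (@ComplexField.Normc.normc R).
Local Notation Re := (@complex.Re R).
Local Notation Im := (@complex.Im R).
Local Notation integrable f := (mu.-integrable setT (EFin \o f)).

Lemma powR2_norm (a : R) : `|a| `^ 2 = a ^+ 2.
Proof. by rewrite powR_mulrn// real_normK ?num_real. Qed.

Lemma bounded_Lfun2 (f : T -> R) c : measurable_fun setT f ->
  (forall x, `|f x| <= c) -> f \in Lfun mu 2%:E.
Proof.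
move=> mf fc; rewrite inE/=; apply/andP; split; rewrite inE//=.
rewrite /finite_norm unlock /= ; apply: poweR_lty.
apply: (@le_lt_trans _ _ (\int[mu]_x (c ^+ 2)%:E)%E).
  apply: ge0_le_integral => //.
  - under eq_fun do rewrite powR2_norm.
    by apply/measurable_EFinP; exact: measurable_funX.
  move=> x _; rewrite /= powR2_norm lee_fin.
  rewrite -real_normK ?num_real// ler_pXn2r ?nnegrE//.
  exact: le_trans (normr_ge0 _) (fc x).
apply: integrable_lty => //; exact: finite_measure_integrable_cst.
Qed.

Lemma L2C_cmeasurable (f : T -> R[i]) : L2C mu f -> cmeasurable f.
Proof.
by case=> rL iL; split; [move: rL|move: iL] => /sub_Lfun_mfun; rewrite inE.
Qed.

Lemma bounded_L2C (f : T -> R[i]) c : cmeasurable f ->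
  (forall x, normc (f x) <= c) -> L2C mu f.
Proof.
move=> [mr mi] fc; split; apply: (@bounded_Lfun2 _ c) => // x.
  exact: le_trans (Re_le_normc _) (fc x).
exact: le_trans (Im_le_normc _) (fc x).
Qed.

(** Domination by a multiple of a square integrable weight is how pointwise
    estimates are turned into L2 estimates. *)
Lemma L2norm_le (f : T -> R[i]) (rho : T -> R) c : cmeasurable f ->
  measurable_fun setT rho -> integrable (fun x => rho x ^+ 2) -> 0 <= c ->
  {ae mu, forall x, normc (f x) <= c * rho x} ->
  (L2norm mu f <= (c * Num.sqrt (\int[mu]_x (rho x ^+ 2)))%:E)%E.
Proof.
move=> mf mrho irho c0 fr.
have i0 : 0 <= \int[mu]_x (rho x ^+ 2) by apply: Rintegral_ge0 => x _; exact: sqr_ge0.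
have -> : (c * Num.sqrt (\int[mu]_x (rho x ^+ 2)))%:E =
    (((c ^+ 2 * \int[mu]_x (rho x ^+ 2))%:E `^ 2^-1)%E : \bar R).
  by rewrite /= powR12_sqrt ?mulr_ge0 ?sqr_ge0// sqrtrM ?sqr_ge0// sqrtr_sqr ger0_norm.
rewrite /L2norm unlock; apply: gt0_ler_poweR => //.
- by rewrite in_itv /= leey andbT; apply: integral_ge0 => x _; rewrite lee_fin powR_ge0.
- by rewrite in_itv /= leey andbT lee_fin mulr_ge0// sqr_ge0.
have ic := integrableZR (c ^+ 2) irho.
rewrite -RintegralZl// /Rintegral fineK; last exact: integrable_fin_num ic.
have pE x : (`|(normc (f x))%:E| `^ 2)%E = (normc (f x) ^+ 2)%:E.
  by rewrite /= powR2_norm.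
apply: ae_ge0_le_integral => //.
- by move=> x _; rewrite lee_fin powR_ge0.
- under eq_fun do rewrite pE.
  by apply/measurable_EFinP; apply: measurable_funX; exact: measurable_normc.
- by move=> x _; rewrite lee_fin mulr_ge0 ?sqr_ge0.
- exact: (measurable_int _ ic).
apply: filterS fr => x fx _; rewrite pE lee_fin -exprMn.
rewrite ler_pXn2r ?nnegrE ?normc_ge0//.
exact: le_trans (normc_ge0 _) fx.
Qed.

End SquareIntegrable.

Section Solutions.
Context d (T : measurableType d) (R : realType).
Variable mu : {finite_measure set T -> \bar R}.
Local Notation normc := (@ComplexField.Normc.normc R).
Local Notation Re := (@complex.Re R).
Local Notation Im := (@complex.Im R).
Variable s : T * T -> R.

(** The equation on an arbitrary finite measure space. *)
Definition kernel_solution (z : R[i]) (g : T -> R[i]) : Prop :=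
  [/\ L2C mu g, {ae mu, forall x, upper_half_plane (g x)} &
    {ae mu, forall x, g x =
      - (1 / (z + cintegral mu (fun y => (s (x, y))%:C * g y)))}].

Section TameModification.
Variable k : T -> T -> R.
Hypothesis ms : measurable_fun setT s.
Hypothesis tk : tame_kernel mu k.
Hypothesis ks : {ae mu, forall x, {ae mu, forall y, k x y = s (x, y)}}.

Let mk : measurable_fun setT (fun p : T * T => k p.1 p.2).
Proof. by case: tk. Qed.
Let k_ge0 x y : 0 <= k x y. Proof. by case: tk. Qed.
Let mkx x : measurable_fun setT (k x).
Proof. exact: (measurable_fun_pair2 x mk). Qed.

Lemma ae_cintegral_kernelE : {ae mu, forall x, forall g : T -> R[i],
  cmeasurable g ->
  cintegral mu (fun y => (s (x, y))%:C * g y) = kernel_op mu k g x}.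
Proof.
apply: filterS ks => x kx g mg; apply: ae_eq_cintegral.
- apply: cmeasurable_scale => //; exact: (measurable_fun_pair2 x ms).
- exact: cmeasurable_scale.
by apply: filterS kx => y ->.
Qed.

Lemma kernel_op_ae_eq (g h : T -> R[i]) : cmeasurable g -> cmeasurable h ->
  {ae mu, forall x, g x = h x} -> kernel_op mu k g = kernel_op mu k h.
Proof.
move=> mg mh gh; apply/funext => x; apply: ae_eq_cintegral.
- exact: cmeasurable_scale.
- exact: cmeasurable_scale.
by apply: filterS gh => y ->.
Qed.

Lemma fixed_point_is_solution (eta : R) z g : 0 < eta -> eta <= Im z ->
  half_disk_fun eta g -> g = qve_map mu k z g -> kernel_solution z g.
Proof.
move=> eta0 ez gb gE; have [mg gn] := gb; split.
- by apply: (@bounded_L2C _ _ _ _ _ eta^-1) => // x; case: (gn x).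
- by apply/nearW => x; rewrite gE; exact: (Im_qve_map_gt0 mu k_ge0 eta0 x ez gb).
by move: ae_cintegral_kernelE; apply: filterS => x Sx; rewrite Sx// {1}gE.
Qed.

(** The equation bounds |h| by 1 / eta almost everywhere. Cutting h off outside the
    half disk does not change its integral against any row of k, so applying the
    map once more gives an everywhere solution. *)
Lemma solution_is_fixed_point (eta : R) z h : 0 < eta -> eta <= Im z ->
  kernel_solution z h -> exists g, [/\ half_disk_fun eta g, g = qve_map mu k z g &
    {ae mu, forall x, h x = g x}].
Proof.
move=> eta0 ez [hL h_up hE]; have mh := L2C_cmeasurable hL; have [mr mi] := mh.
(* Im h >= 0 only almost everywhere; the integrand equals its positive part. *)
have ImS x : 0 <= Im (kernel_op mu k h x).
  rewrite /kernel_op Im_wcintegral /Rintegral fine_ge0//.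
  rewrite (@ae_eq_integral _ _ _ _ _
    (fun y => (Num.max 0 (k x y * Im (h y)))%:E)) //.
  - by apply: integral_ge0 => y _; rewrite lee_fin le_max lexx.
  - by apply/measurable_EFinP; exact: measurable_funM.
  - apply/measurable_EFinP; apply: measurable_maxr => //; exact: measurable_funM.
  apply: filterS h_up => y hy _; congr EFin; apply/esym/max_idPr.
  by rewrite mulr_ge0// ltW.
have hPhi : {ae mu, forall x, h x = qve_map mu k z h x}.
  by apply: filterS2 ae_cintegral_kernelE hE => x Sx ->; rewrite Sx.
pose A := [set x | 0 <= Im (h x)] `&` [set x | normc (h x) <= eta^-1].
have mA : measurable A.
  apply: measurableI.
    rewrite (_ : [set _ | _] = setT `&` (Im \o h) @^-1` `[0, +oo[).
      by apply: mi => //; exact: measurable_itv.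
    by rewrite setTI; apply/seteqP; split => x /=; rewrite in_itv /= andbT.
  rewrite (_ : [set _ | _] = setT `&` (normc \o h) @^-1` `]-oo, eta^-1]).
    by apply: (measurable_normc mh) => //; exact: measurable_itv.
  by rewrite setTI; apply/seteqP; split => x /=; rewrite in_itv.
pose h2 x : R[i] := (\1_A x)%:C * h x.
have h2b : half_disk_fun eta h2.
  split; first by apply: cmeasurable_scale => //; exact: measurable_indic.
  move=> x; rewrite /h2 indicE; have [xA|_] := boolP (x \in A).
    by rewrite mul1r; move: xA; rewrite inE => -[].
  rewrite mul0r ComplexField.Normc.normc0; split; first exact: lexx.
  by rewrite invr_ge0 ltW.
have hh2 : {ae mu, forall x, h x = h2 x}.
  apply: filterS2 h_up hPhi => x hx hE'; rewrite /h2 indicE mem_set ?mul1r//.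
  split => /=; first exact: ltW.
  by rewrite hE'; apply: normc_Ninv_le => //; rewrite ImD (le_trans ez)// lerDl.
have [mh2 _] := h2b; have S2 := kernel_op_ae_eq mh mh2 hh2.
pose g := qve_map mu k z h2.
have hg : {ae mu, forall x, h x = g x}.
  by apply: filterS hPhi => x ->; rewrite /g /qve_map S2.
have [rho [C w]] : exists rho C, sublinear_weight mu k (eta ^+ 2 / 2) rho C.
  by case: tk => _ _; apply; rewrite divr_gt0 ?exprn_gt0.
have gb : half_disk_fun eta g by exact: (half_disk_fun_qve_map mk k_ge0 eta0 w).
exists g; split => //; have [mg _] := gb.
by rewrite [in RHS]/qve_map -(kernel_op_ae_eq mh mg hg) S2.
Qed.

Lemma solutions_holomorphic (G : R[i] -> T -> R[i]) :
  (forall z, upper_half_plane z -> kernel_solution z (G z)) ->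
  holomorphic_L2 mu (@upper_half_plane R) G.
Proof.
move=> GS z uz; have [GL _ _] := GS z uz; split=> //.
pose eta := Im z / 2.
have eta0 : 0 < eta by rewrite divr_gt0.
have ez : eta <= Im z by have : 0 < Im z := uz; rewrite /eta; lra.
have up z' : eta <= Im z' -> upper_half_plane z' by exact: lt_le_trans.
have /choice[g gP] : forall z', exists g : T -> R[i], eta <= Im z' ->
    [/\ half_disk_fun eta g, g = qve_map mu k z' g &
      {ae mu, forall x, G z' x = g x}].
  move=> z'.
  have [ez'|_] := boolP (eta <= Im z'); last by exists (fun=> 0).
  by have [g ?] := solution_is_fixed_point eta0 ez' (GS z' (up z' ez')); exists g.
have [rho [C w]] : exists rho C, sublinear_weight mu k (eta ^+ 2 / 2) rho C.
  by case: tk => _ _; apply; rewrite divr_gt0 ?exprn_gt0.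
have [mrho rho1 irho _ _] := w.
have gs z' : eta <= Im z' -> half_disk_fun eta (g z') /\ g z' = qve_map mu k z' (g z').
  by move=> /gP[].
have [d' [md db] [K K0 dK]] := solution_derivative mk k_ge0 eta0 w ez gs.
exists d'; first exact: bounded_L2C md db.
pose N := Num.sqrt (\int[mu]_x (rho x ^+ 2)).
have near0 (e : R) : 0 < e -> \forall h \near (0 : R[i]^o)^', h != 0 /\ normc h < e.
  move=> e0; have e0' : 0 < (e%:C : R[i]) by rewrite ltcR.
  apply: filterS2 (@nbhs_dnbhs_neq (R[i]^o : topologicalType) 0)
    (@dnbhs0_lt R[i] (R[i]^o) _ e0') => h hn he; split => //.
  by move: he; rewrite normc_def ltcR; case: (h).
have bound : \forall h \near (0 : R[i]^o)^',
    (0 <= L2norm mu (fun x => h^-1 * (G (z + h) x - G z x) - d' x)%R <=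
      (normc h * K * N)%R%:E)%E.
  apply: filterS (near0 _ eta0) => h [h0 he].
  have eh : eta <= Im (z + h).
    have := le_trans (ler_norm _) (Im_le_normc (- h)).
    rewrite normcN ImD (_ : Im (- h) = - Im h); last by case: (h).
    by move: he; rewrite /eta; lra.
  have [[mgh _] _ Gh] := gP _ eh; have [[mgz _] _ Gz] := gP _ ez.
  apply/andP; split; first exact: Lnorm_ge0.
  have [GhL _ _] := GS _ (up _ eh).
  apply: L2norm_le => //.
  - apply: cmeasurableB => //; apply: cmeasurableZ.
    apply: cmeasurableB; first exact: L2C_cmeasurable GhL.
    exact: L2C_cmeasurable GL.
  - by rewrite mulr_ge0 ?normc_ge0.
  by apply: filterS2 Gh Gz => x -> ->; exact: dK.
apply: (squeeze_cvge bound); first exact: cvg_cst.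
apply: cvg_EFin; first exact: nearW.
apply/cvgrPdist_le => e e0.
have Kp : 0 < `|K * N| + 1 by rewrite ltr_wpDl.
have := near0 (e / (`|K * N| + 1)); rewrite divr_gt0// => /(_ isT).
apply: filterS => h [_ he].
rewrite /= sub0r normrN -mulrA normrM ger0_norm ?normc_ge0//.
apply: (@le_trans _ _ (normc h * (`|K * N| + 1))).
  by rewrite ler_wpM2l ?normc_ge0// lerDl.
by rewrite -ler_pdivlMr// ltW.
Qed.

End TameModification.

Lemma kernel_solution_theory : s \in Lfun (mu \x mu)%E 2%:E ->
  {ae (mu \x mu)%E, forall p, 0 <= s p} ->
  (forall z, upper_half_plane z -> exists g, kernel_solution z g /\
    forall h, kernel_solution z h -> {ae mu, forall x, h x = g x}) /\
  (forall G : R[i] -> T -> R[i],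
    (forall z, upper_half_plane z -> kernel_solution z (G z)) ->
    holomorphic_L2 mu (@upper_half_plane R) G).
Proof.
move=> s_L2 s_ge0; have [ms [k tk ks]] := tame_modification s_L2 s_ge0.
split; last by move=> G; exact: solutions_holomorphic ms tk ks G.
move=> z uz; pose eta := Im z.
have eta0 : 0 < eta by exact: uz.
have [mk k0 wk] := tk.
have [|rho [C w]] := wk (eta ^+ 2 / 2); first by rewrite divr_gt0 ?exprn_gt0.
have [g [gb gE]] := solution_exists mk k0 eta0 w (lexx eta).
exists g; split; first exact: (fixed_point_is_solution ms tk ks eta0 (lexx _) gb gE).
move=> h hs.
have [g' [g'b g'E hg']] := solution_is_fixed_point ms tk ks eta0 (lexx _) hs.
by rewrite (solution_unique mk k0 eta0 w (lexx _) gb g'b gE g'E).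
Qed.

End Solutions.

Theorem theoremA1 (R : realType) (s : R * R -> R)
    (s_L2 : s \in Lfun (mu01 R \x mu01 R)%E 2%:E)
    (s_ge0 : {ae (mu01 R \x mu01 R)%E, forall p, 0 <= s p}) :
  (forall z : R[i], upper_half_plane z ->
    exists g : R -> R[i], is_solution s z g /\
      forall h : R -> R[i], is_solution s z h -> {ae mu01 R, forall x, h x = g x}) /\
  (forall G : R[i] -> R -> R[i],
    (forall z, upper_half_plane z -> is_solution s z (G z)) ->
    holomorphic_L2 (mu01 R) (@upper_half_plane R) G).
Proof. exact: (kernel_solution_theory s_L2 s_ge0). Qed.
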